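(* Let $\Gamma=(\gamma_1,\dots,\gamma_r)$ be a tuple of symmetric free polynomials in $x=(x_1,\dots,x_g)$ with $g\le r$ and $\gamma_j=x_j$ for $1\le j\le g$. Suppose $\mathfrak K\subseteq B(\mathcal H)^g_{sa}$ is SOT-closed, operator $\Gamma$-convex, bounded, and that $0\in\mathrm{opco}(\Gamma(\mathfrak K))$. For each $Y\in B(\mathcal H)^g_{sa}\setminus\mathfrak K$ there is a positive integer $N$ and a monic linear pencil $M=I_N+\sum_{j=1}^rA_jx_j$ of size $N$ (in $r$ variables) such that $M(Z)\succeq0$ for all $Z\in\mathrm{opco}(\Gamma(\mathfrak K))$, but $M(\Gamma(Y))\not\succeq0$. Thus the $\Gamma$-pencil $L=M\circ\Gamma=I_N+\sum_jA_j\gamma_j$ is positive semidefinite on $\mathfrak K$, but $L(Y)\not\succeq0$. In particular, $\mathfrak K=\bigcap\widehat{\mathfrak D}_L$, where the intersection is over all monic $\Gamma$-pencils $L$ such that $\widehat{\mathfrak D}_L\supseteq\mathfrak K$. Finally, suppose $0\in\mathfrak K$ and $\Gamma(0)=0$. If $\ell$ is a positive integer, $\mathscr F$ is an $\ell$-dimensional subspace of $\mathcal H$ and $Y=Y'\oplus0$ (with $Y\notin\mathfrak K$) with respect to the orthogonal decomposition $\mathscr F\oplus\mathscr F^\perp$ of $\mathcal H$, then $L$ and $M$ can be chosen to have size $\ell$.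
   Context: $\mathcal H$ is a fixed infinite-dimensional separable complex Hilbert space and $B(\mathcal H)^g_{sa}$ is the set of $g$-tuples of bounded self-adjoint operators on $\mathcal H$, with norm $\|X\|=\max_j\|X_j\|$; the strong operator topology (SOT) on tuples is taken coordinatewise. Free polynomials are elements of the free algebra $\mathbb C\langle x\rangle$ in noncommuting variables, with the conjugate-linear involution fixing each $x_j$ and reversing words; symmetric means $p^*=p$. $\Gamma(X)=(\gamma_1(X),\dots,\gamma_r(X))$ for $X\in B(\mathcal H)^g_{sa}$. A set $\mathfrak K\subseteq B(\mathcal H)^g_{sa}$ is free if it is closed under simultaneous unitary similarity and under (finite) direct sums, where $\mathcal H\oplus\cdots\oplus\mathcal H$ is identified with $\mathcal H$ by a unitary. A pair $(X,V)$ with $X\in B(\mathcal H)^g_{sa}$ and $V:\mathcal H\to\mathcal H$ an isometry is an (operator) $\Gamma$-pair if $V^*\Gamma(X)V=\Gamma(V^*XV)$ (coordinatewise). $\mathfrak K$ is operator $\Gamma$-convex if it is free and $V^*XV\in\mathfrak K$ whenever $X\in\mathfrak K$ and $(X,V)$ is a $\Gamma$-pair. Operator convex means free and closed under $X\mapsto V^*XV$ for all isometries $V$ on $\mathcal H$; $\mathrm{opco}(\mathfrak S)$, the operator convex hull, is the intersection of all operator convex sets containing $\mathfrak S$. A monic $\Gamma$-pencil of size $N$ is $L=I_N+\sum_{j=1}^rA_j\gamma_j$ with $A_j$ self-adjoint $N\times N$ complex matrices, evaluated by $L(X)=I_N\otimes I_{\mathcal H}+\sum_jA_j\otimes\gamma_j(X)$;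 a monic linear pencil is the case where the $\gamma_j$ are just the variables, so $M(Z)=I_N\otimes I_{\mathcal H}+\sum_jA_j\otimes Z_j$ for $Z\in B(\mathcal H)_{sa}^r$. $\widehat{\mathfrak D}_L=\{X\in B(\mathcal H)^g_{sa}:L(X)\succeq0\}$. *)

(* Defs.v *)
From HB Require Import structures.
From mathcomp Require Import all_boot all_order all_algebra.
From mathcomp Require Import sesquilinear.
From mathcomp Require Import finmap.
From mathcomp Require Import complex.
From mathcomp Require Import monalg.
From mathcomp Require Import all_classical all_reals all_analysis.

Set Implicit Arguments.
Unset Strict Implicit.
Unset Printing Implicit Defensive.

Import Order.TTheory GRing.Theory Num.Theory.
Import numFieldNormedType.Exports.

Local Open Scope classical_set_scope.
Local Open Scope complex_scope.
Local Open Scope ring_scope.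

Section HilbertSpace.
Context {R : realType} {H : completeNormedModType R[i]}.

Definition separable_space : Prop := exists2 D : set H, countable D & dense D.

Definition span n (b : 'I_n -> H) : set H :=
  [set v | exists c : 'I_n -> R[i], v = \sum_i c i *: b i].

Definition infinite_dimensional : Prop :=
  forall n (b : 'I_n -> H), span b <> setT.

Definition lin_independent n (b : 'I_n -> H) : Prop :=
  forall c : 'I_n -> R[i], \sum_i c i *: b i = 0 -> forall i, c i = 0.

Definition subspace_of_dim n (F : set H) : Prop :=
  exists2 b : 'I_n -> H, lin_independent b & F = span b.

Definition bounded_op (T : H -> H) : Prop :=
  linear T /\ exists M : R[i], forall v, `|T v| <= M * `|v|.

(* Norms in H take values in the nonnegative real axis of R[i], hence [Re]. *)
Definition opnorm (T : H -> H) : R :=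
  sup [set complex.Re `|T v| | v in [set v : H | `|v| <= 1]].

End HilbertSpace.

Arguments separable_space {R} H.
Arguments infinite_dimensional {R} H.

(* A [g]-tuple of operators is a function ['I_g -> H -> H]; boundedness and
   linearity are imposed by [sa_tuple]. *)
Section Operators.
Context {R : realType} {H : completeNormedModType R[i]}.
Variable ip : {dot H for @Num.conj R[i]}.

(* The inner product is linear in its first argument. By the Riesz theorem the
   vector selected by [get] exists, and is unique, whenever [T] is bounded. *)
Definition adjoint (T : H -> H) (v : H) : H :=
  get [set w : H | forall u, ip (T u) v = ip u w].

Definition selfadjoint (T : H -> H) : Prop :=
  forall u v, ip (T u) v = ip u (T v).

Definition isometry_op (V : H -> H) : Prop :=
  linear V /\ forall u v, ip (V u) (V v) = ip u v.

Definition unitary_op (U : H -> H) : Prop :=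
  isometry_op U /\ forall v, exists u, U u = v.

Definition sa_tuple g : set ('I_g -> H -> H) :=
  [set X | forall j, bounded_op (X j) /\ selfadjoint (X j)].

Definition zero_tuple g : 'I_g -> H -> H := fun _ _ => 0.

Definition tuple_norm g (X : 'I_g -> H -> H) : R :=
  \big[Num.max/0]_(j < g) opnorm (X j).

Definition norm_bounded g (K : set ('I_g -> H -> H)) : Prop :=
  exists M : R, forall X, K X -> tuple_norm X <= M.

(* The strong operator topology is the topology of pointwise convergence on H;
   closedness is relative to the self-adjoint tuples, since a pointwise limit
   of a net of bounded operators need not be bounded. *)
Definition sot_closed g (K : set ('I_g -> H -> H)) : Prop :=
  closure (K : set {ptws 'I_g -> {ptws H -> H}}) `&` sa_tuple (g := g) `<=` K.

(* [compress V X] is V^* X V. *)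
Definition compress g (V : H -> H) (X : 'I_g -> H -> H) : 'I_g -> H -> H :=
  fun j v => adjoint V (X j (V v)).

(* [W] is a unitary from the n-fold direct sum of H (realized as ['I_n -> H])
   onto H, with inverse [W']. *)
Definition sum_unitary n (W : ('I_n -> H) -> H) (W' : H -> 'I_n -> H) : Prop :=
  [/\ linear W,
      forall h k, ip (W h) (W k) = \sum_i ip (h i) (k i),
      cancel W W' & cancel W' W].

Definition direct_sum g n (W : ('I_n -> H) -> H) (W' : H -> 'I_n -> H)
    (X : 'I_n -> 'I_g -> H -> H) : 'I_g -> H -> H :=
  fun j v => W (fun i => X i j (W' v i)).

Definition free_set g (K : set ('I_g -> H -> H)) : Prop :=
  [/\ K `<=` sa_tuple (g := g),
      forall X U, K X -> unitary_op U -> K (compress U X) &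
      forall n W W' (X : 'I_n -> 'I_g -> H -> H), (0 < n)%N ->
        sum_unitary W W' -> (forall i, K (X i)) -> K (direct_sum W W' X)].

Definition operator_convex g (K : set ('I_g -> H -> H)) : Prop :=
  free_set K /\ forall X V, K X -> isometry_op V -> K (compress V X).

Definition opco g (S : set ('I_g -> H -> H)) : set ('I_g -> H -> H) :=
  \bigcap_(C in [set C | operator_convex C /\ S `<=` C]) C.

(* [Y = Y' (+) 0] for the decomposition of H as F (+) F^perp; for self-adjoint
   [Y] the compression [Y'] of [Y] to F is automatically self-adjoint. *)
Definition supported_on g (F : set H) (Y : 'I_g -> H -> H) : Prop :=
  forall j, (forall v, F v -> F (Y j v)) /\
            (forall v, (forall u, F u -> ip u v = 0) -> Y j v = 0).

End Operators.

Arguments zero_tuple {R} H g.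

(* The free algebra is the monoid algebra of the free monoid. *)
Notation free_poly C g := {malg C[{fmonom 'I_g}]}.

Section FreePolynomials.
Context {R : realType} {H : completeNormedModType R[i]}.
Variable g : nat.

Definition fvar (j : 'I_g) : free_poly R[i] g := << fmu j >>.

Definition fstar (p : free_poly R[i] g) : free_poly R[i] g :=
  \sum_(w <- msupp p) << Num.conj p@_w *g FMonom (rev w) >>.

Definition fsymmetric (p : free_poly R[i] g) : Prop := fstar p = p.

Definition word_eval (X : 'I_g -> H -> H) (w : seq 'I_g) (v : H) : H :=
  foldr (fun j => X j) v w.

Definition poly_eval (p : free_poly R[i] g) (X : 'I_g -> H -> H) (v : H) : H :=
  \sum_(w <- msupp p) p@_w *: word_eval X w v.

Definition tuple_eval r (Gam : 'I_r -> free_poly R[i] g)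
    (X : 'I_g -> H -> H) : 'I_r -> H -> H :=
  fun j => poly_eval (Gam j) X.

End FreePolynomials.

Section GammaConvexity.
Context {R : realType} {H : completeNormedModType R[i]}.
Variable ip : {dot H for @Num.conj R[i]}.
Variables (g r : nat) (Gam : 'I_r -> free_poly R[i] g).

Definition gamma_pair (X : 'I_g -> H -> H) (V : H -> H) : Prop :=
  [/\ sa_tuple ip X, isometry_op ip V &
      compress ip V (tuple_eval Gam X) = tuple_eval Gam (compress ip V X)].

Definition gamma_convex (K : set ('I_g -> H -> H)) : Prop :=
  free_set ip K /\
  forall X V, K X -> gamma_pair X V -> K (compress ip V X).

End GammaConvexity.

Section Pencils.
Context {R : realType} {H : completeNormedModType R[i]}.
Variable ip : {dot H for @Num.conj R[i]}.
Variables (r N : nat).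
Implicit Types A : 'I_r -> 'M[R[i]]_N.

(* The tensor product of C^N with H is realized as ['I_N -> H], on which
   (A (x) T) h has i-th coordinate \sum_k A i k *: T (h k). *)
Definition psd (T : ('I_N -> H) -> 'I_N -> H) : Prop :=
  forall h, 0 <= \sum_i ip (T h i) (h i).

Definition hermitian_coeffs A : Prop := forall j, A j \is hermsymmx.

Definition linear_pencil A (Z : 'I_r -> H -> H) :
    ('I_N -> H) -> 'I_N -> H :=
  fun h i => h i + \sum_j \sum_k A j i k *: Z j (h k).

Definition gamma_pencil g A (Gam : 'I_r -> free_poly R[i] g)
    (X : 'I_g -> H -> H) : ('I_N -> H) -> 'I_N -> H :=
  linear_pencil A (tuple_eval Gam X).

Definition pencil_domain g A (Gam : 'I_r -> free_poly R[i] g) :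
    set ('I_g -> H -> H) :=
  [set X | sa_tuple ip X /\ psd (gamma_pencil A Gam X)].

Definition separates g A (Gam : 'I_r -> free_poly R[i] g)
    (K : set ('I_g -> H -> H)) (Y : 'I_g -> H -> H) : Prop :=
  [/\ (forall Z, opco ip (tuple_eval Gam @` K) Z -> psd (linear_pencil A Z)),
      ~ psd (linear_pencil A (tuple_eval Gam Y)),
      (forall X, K X -> psd (gamma_pencil A Gam X)) &
      ~ psd (gamma_pencil A Gam Y)].

End Pencils.

(* Main.v *)
(* Write Q_N for the set of moment data (<k_b, k_a>, <gamma_j(X) k_b, k_a>) with
   X in K and k_1, ..., k_N in H: since K is closed under direct sums it is a
   convex cone in a finite-dimensional space.  Take N orthonormal vectors f_a.

   If the data of (Y, f) lie outside the closure of Q_N, a separating functional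
   is a form rho (x) I + sum_j B_j (x) Z_j that is nonnegative on Gamma(K) and
   negative at Gamma(Y).  The tuples where such a form is nonnegative are operator
   convex, so nonnegativity persists on opco(Gamma(K)); evaluating at 0 gives
   rho >= 0, and after adding a small multiple of I to rho a congruence makes the
   pencil monic.

   Otherwise (Y, f) is a limit of data (X_n, k_n).  A Gram-Schmidt process adapted
   to X_n and k_n, with a sparsity pattern independent of n, yields isometries
   that intertwine X_n with their compressions; these lie in K because the range
   is reducing, and they converge strongly along an ultrafilter since every basis
   vector is mapped into a fixed finite-dimensional space.  The limit X is in K
   and has exactly the moments of (Y, f).  With f an orthonormal basis, Y is the
   compression of X by the isometry f_a |-> kappa_a, a Gamma-pair, so Y is in K.
   If Y = Y' (+) 0 it suffices to match the moments of a basis of the support of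
   Y and to compress X (+) 0 instead. *)
Require Import Defs.
From mathcomp Require Import all_boot all_order all_algebra.
From mathcomp Require Import sesquilinear spectral.
From mathcomp Require Import finmap complex monalg.
From mathcomp Require Import all_classical all_reals all_analysis.
From mathcomp Require Import ring lra.

Import Order.TTheory GRing.Theory Num.Theory.
Import numFieldNormedType.Exports.

Local Open Scope classical_set_scope.
Local Open Scope complex_scope.
Local Open Scope ring_scope.

Set Implicit Arguments.
Unset Strict Implicit.
Unset Printing Implicit Defensive.

(** * Inner products and Gram-Schmidt *)

Section InnerProduct.
Context {R : realType} {H : completeNormedModType R[i]}.
Context {ip : {dot H for @Num.conj R[i]}}.

Lemma ipDl u v w : ip (u + v) w = ip u w + ip v w.
Proof. exact: linearDl. Qed.

Lemma ipDr u v w : ip u (v + w) = ip u v + ip u w.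
Proof. exact: linearDr. Qed.

Lemma ipBl u v w : ip (u - v) w = ip u w - ip v w.
Proof. exact: linearBl. Qed.

Lemma ipBr u v w : ip u (v - w) = ip u v - ip u w.
Proof. exact: linearBr. Qed.

Lemma ip0l w : ip 0 w = 0.
Proof. exact: linear0l. Qed.

Lemma ip0r w : ip w 0 = 0.
Proof. exact: linear0r. Qed.

Lemma ipZl a u w : ip (a *: u) w = a * ip u w.
Proof. exact: linearZl_LR. Qed.

Lemma ipZr a u w : ip u (a *: w) = a^* * ip u w.
Proof. exact: linearZr_LR. Qed.

Lemma ipC u v : ip u v = (ip v u)^*.
Proof. by rewrite (hermC ip) /= expr0 mul1r. Qed.

Lemma ip_suml I (s : seq I) P (F : I -> H) w :
  ip (\sum_(i <- s | P i) F i) w = \sum_(i <- s | P i) ip (F i) w.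
Proof. exact: linear_sumlz. Qed.

Lemma ip_sumr I (s : seq I) P (F : I -> H) w :
  ip w (\sum_(i <- s | P i) F i) = \sum_(i <- s | P i) ip w (F i).
Proof. exact: linear_sumr. Qed.

Lemma ip_eq0 u : (ip u u == 0) = (u == 0).
Proof. exact: dnorm_eq0. Qed.

Lemma ip_extl u v : (forall w, ip u w = ip v w) -> u = v.
Proof.
by move=> uv; apply/eqP; rewrite -subr_eq0 -ip_eq0 ipBl uv subrr.
Qed.

Lemma ip_extr u v : (forall w, ip w u = ip w v) -> u = v.
Proof. by move=> uv; apply: ip_extl => w; rewrite ipC uv -ipC. Qed.

Definition orthonormal_family (I : eqType) (b : I -> H) : Prop :=
  forall i j, ip (b i) (b j) = (i == j)%:R.

Lemma ip_lincomb (I : finType) (b : I -> H) (c d : I -> R[i]) :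
  orthonormal_family b ->
  ip (\sum_i c i *: b i) (\sum_i d i *: b i) = \sum_i c i * (d i)^*.
Proof.
move=> ob; rewrite ip_suml; apply: eq_bigr => i _.
rewrite ip_sumr (bigD1 i) //= big1 ?addr0 => [|j ji].
  by rewrite ipZl ipZr ob eqxx mulr1.
by rewrite ipZl ipZr ob eq_sym (negbTE ji) !mulr0.
Qed.

Lemma ip_lincombl (I : finType) (b : I -> H) (c : I -> R[i]) j :
  orthonormal_family b -> ip (\sum_i c i *: b i) (b j) = c j.
Proof.
move=> ob; rewrite ip_suml (bigD1 j) //= big1 ?addr0 => [|i ij].
  by rewrite ipZl ob eqxx mulr1.
by rewrite ipZl ob (negbTE ij) mulr0.
Qed.

Lemma ip_ge0 u : 0 <= ip u u. Proof. exact: dnorm_ge0. Qed.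

(** For orthonormal [b] this is the orthogonal projection onto the span of [b]; membership of [v] in
    that span is written [v = oproj b v] throughout. *)
Definition oproj (I : finType) (b : I -> H) (v : H) : H :=
  \sum_i ip v (b i) *: b i.

Section Projection.
Context (I : finType) (b : I -> H) (ob : orthonormal_family b).

Lemma ip_oproj v j : ip (oproj b v) (b j) = ip v (b j).
Proof. exact: ip_lincombl. Qed.

Lemma oproj_orth v j : ip (v - oproj b v) (b j) = 0.
Proof. by rewrite ipBl ip_oproj subrr. Qed.

Lemma oproj_orth_lincomb v c : ip (v - oproj b v) (\sum_i c i *: b i) = 0.
Proof. by rewrite ip_sumr big1 // => i _; rewrite ipZr oproj_orth mulr0. Qed.

Lemma oproj_lincomb c : oproj b (\sum_i c i *: b i) = \sum_i c i *: b i.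
Proof. by apply: eq_bigr => j _; rewrite ip_lincombl. Qed.

Lemma oproj_linear : linear (oproj b).
Proof.
move=> a u v; rewrite /oproj scaler_sumr -big_split; apply: eq_bigr => i _ /=.
by rewrite ipDl ipZl scalerDl scalerA.
Qed.

End Projection.

Lemma oprojE (I : finType) (b : I -> H) v (c : I -> R[i]) :
  orthonormal_family b -> v = \sum_i c i *: b i -> v = oproj b v.
Proof. by move=> ob ->; rewrite oproj_lincomb. Qed.

End InnerProduct.
Arguments orthonormal_family {R H} ip {I} b.
Arguments oproj {R H} ip {I} b v.

Section Norm.
Context {R : realType} {H : completeNormedModType R[i]}.
Context {ip : {dot H for @Num.conj R[i]}}.
Context (ip_norm : forall v : H, ip v v = `|v| ^+ 2).

Lemma ler_sqr_norm (u v : H) : (ip u u <= ip v v) = (`|u| <= `|v|).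
Proof. by rewrite !ip_norm ler_sqr // nnegrE. Qed.

Lemma pythagoras u v : ip u v = 0 -> ip (u + v) (u + v) = ip u u + ip v v.
Proof. by move=> uv; rewrite ipDl !ipDr uv (ipC v) uv rmorph0 addr0 add0r. Qed.

Lemma norm_orthD u v : ip u v = 0 -> `|u| <= `|u + v|.
Proof. by move=> uv; rewrite -ler_sqr_norm pythagoras // lerDl ip_ge0. Qed.

(** The component [a *: v] of [u] along [v] is orthogonal to the remainder, so by Pythagoras its
    norm is at most that of [u]. *)
Lemma cauchy_schwarz u v : `|ip u v| <= `|u| * `|v|.
Proof.
have [->|v0] := eqVneq v 0; first by rewrite ip0r !normr0 mulr0.
have vv0 : ip v v != 0 by rewrite ip_eq0.
set a := ip u v / ip v v.
have oa : ip (a *: v) (u - a *: v) = 0.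
  by rewrite ipC ipZr ipBl ipZl /a divfK // subrr mulr0 rmorph0.
have := norm_orthD oa; rewrite addrC subrK normrZ /a normrM normfV.
have -> : `|ip v v| = `|v| * `|v| by rewrite ip_norm normrX normr_id expr2.
have vp : 0 < `|v| by rewrite normr_gt0.
by rewrite invfM -!mulrA mulVf ?gt_eqF // mulr1 ler_pdivrMr.
Qed.

Lemma norm1 u : ip u u = 1 -> `|u| = 1.
Proof.
move=> u1; apply/eqP; rewrite -(@eqrXn2 _ 2) // -ip_norm u1 expr1n//.
Qed.

Lemma oproj_best (I : finType) (b : I -> H) v c : orthonormal_family ip b ->
  `|v - oproj ip b v| <= `|v - \sum_i c i *: b i|.
Proof.
move=> ob; have -> : v - \sum_i c i *: b i =
    (v - oproj ip b v) + \sum_i (ip v (b i) - c i) *: b i.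
  rewrite -addrA; congr (_ + _); under [in RHS]eq_bigr do rewrite scalerBl.
  by rewrite sumrB addKr.
by apply: norm_orthD; rewrite oproj_orth_lincomb.
Qed.

Lemma norm_oproj (I : finType) (b : I -> H) v : orthonormal_family ip b ->
  `|oproj ip b v| <= `|v|.
Proof.
move=> ob; rewrite -[in leRHS](subrK (oproj ip b v) v) addrC.
by apply: norm_orthD; rewrite ipC oproj_orth_lincomb // rmorph0.
Qed.

End Norm.

Section GramSchmidt.
Context {R : realType} {H : completeNormedModType R[i]}.
Context {ip : {dot H for @Num.conj R[i]}}.
Context (ip_norm : forall v : H, ip v v = `|v| ^+ 2).
Context (H_infinite : infinite_dimensional H).

(** Normalise the residual of [t]. If [t] already lies in the span, use the residual of any vector
    outside it, so that the process never stalls. *)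
Lemma gram_schmidt_step n (b : 'I_n -> H) t : orthonormal_family ip b ->
  exists u, [/\ ip u u = 1, forall i, ip u (b i) = 0 &
             t = oproj ip b t + ip t u *: u].
Proof.
move=> ob.
have unit w : w != 0 -> (forall i, ip w (b i) = 0) ->
    exists2 u, ip u u = 1 /\ (forall i, ip u (b i) = 0) & w = ip w u *: u.
  move=> w0 wb; have nw : `|w| != 0 by rewrite normr_eq0.
  have cw : (`|w|^-1)^* = `|w|^-1 by apply/CrealP; rewrite rpredV normr_real.
  exists (`|w|^-1 *: w); first split=> [|i].
  - by rewrite ipZl ipZr ip_norm cw expr2 mulrA mulrACA !mulVf // mulr1.
  - by rewrite ipZl wb mulr0.
  by rewrite ipZr ip_norm cw scalerA expr2 mulrA mulVf // mul1r mulfV // scale1r.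
have [t0|t0] := eqVneq (t - oproj ip b t) 0; last first.
  have [u [u1 ub] tu] := unit _ t0 (oproj_orth ob t); exists u; split=> //.
  rewrite -[in LHS](subrK (oproj ip b t) t) addrC {}[in LHS]tu.
  rewrite ipBl (_ : ip (oproj ip b t) u = 0) ?subr0 //.
  by rewrite ip_suml big1 // => i _; rewrite ipZl (ipC (b i)) ub rmorph0 mulr0.
have [v vb] : exists v, v - oproj ip b v != 0.
  apply: contrapT => nv; apply: (@H_infinite n b); apply/seteqP; split=> // v _.
  exists (fun i => ip v (b i)); apply/eqP; rewrite -subr_eq0.
  by apply/negPn/negP => v0; apply: nv; exists v.
have [u [u1 ub] _] := unit _ vb (oproj_orth ob v).
exists u; split=> //; move/eqP: t0; rewrite subr_eq0 => /eqP t0.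
rewrite -t0 t0 ip_suml big1 ?scale0r ?addr0 //.
by move=> i _; rewrite ipZl (ipC (b i)) ub rmorph0 mulr0.
Qed.

(** The vector to be absorbed at stage [k] may depend on the vectors built so far. This lets one
    process serve a dense sequence, a schedule involving [X j (b q)], and a basis of a subspace. *)
Lemma adaptive_gram_schmidt (T : seq H -> H) : exists2 b : nat -> H,
  orthonormal_family ip b &
  forall k, T (mkseq b k) = oproj ip (fun i : 'I_k.+1 => b i) (T (mkseq b k)).
Proof.
pose ob (s : seq H) := orthonormal_family ip (fun i : 'I_(size s) => s`_i).
(* The choice function has to be total; the induction below only applies it to orthonormal lists. *)
have /choice[f fP] s : exists u, ob s ->
    [/\ ip u u = 1, forall i : 'I_(size s), ip u s`_i = 0 &
        T s = oproj ip (fun i : 'I_(size s) => s`_i) (T s) + ip (T s) u *: u].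
  have [os|nos] := pselect (ob s); last by exists 0.
  by have [u uP] := gram_schmidt_step (T s) os; exists u.
pose B := fix B k := if k is k'.+1 then rcons (B k') (f (B k')) else [::].
pose b k := f (B k).
have BE k : B k = mkseq b k.
  by elim: k => //= k IH; rewrite mkseqS -IH.
have lt_ob k : (forall i j, (i < k)%N -> (j < k)%N ->
    ip (b i) (b j) = (i == j)%:R) -> ob (mkseq b k).
  move=> obk [i +] [j +]; rewrite /= size_mkseq => ik jk.
  by rewrite !nth_mkseq // obk.
have obk k : forall i j, (i < k)%N -> (j < k)%N -> ip (b i) (b j) = (i == j)%:R.
  elim: k => // k IH i j; rewrite !ltnS.
  have := fP _ (lt_ob k IH); rewrite -BE -/(b k) BE => -[bk1 bko _].
  have {}bko l : (l < k)%N -> ip (b k) (b l) = 0.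
    move=> lk; have lk' : (l < size (mkseq b k))%N by rewrite size_mkseq.
    by have := bko (Ordinal lk'); rewrite nth_mkseq.
  rewrite (leq_eqVlt i) (leq_eqVlt j) => /predU1P[->|ik] /predU1P[->|jk].
  - by rewrite bk1 eqxx.
  - by rewrite bko // gtn_eqF.
  - by rewrite ipC bko // rmorph0 ltn_eqF.
  - exact: IH.
exists b => [i j|k].
  by apply: (obk (maxn i j).+1); rewrite ltnS ?leq_maxl ?leq_maxr.
have [_ _] := fP _ (lt_ob k (obk k)).
have -> : f (mkseq b k) = b k by rewrite /b BE.
move: (T _) => t; rewrite /oproj big_ord_recr /=.
by rewrite size_mkseq; under eq_bigr do rewrite nth_mkseq //.
Qed.

End GramSchmidt.

(** * Limits and bounded operators *)

Section Limits.
Context {R : realType} {H : completeNormedModType R[i]}.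
Context {ip : {dot H for @Num.conj R[i]}}.
Context (ip_norm : forall v : H, ip v v = `|v| ^+ 2).
Local Notation C := R[i].
Local Notation Co := (R[i]^o).
Context {T : Type} {F : set_system T} {FF : ProperFilter F}.

Lemma cvg_dominated (V : normedModType C) (f : T -> V) (l : V) (g : T -> Co) :
  (\forall n \near F, `|f n - l| <= g n) -> g @ F --> (0 : Co) -> f @ F --> l.
Proof.
move=> fg g0; apply/cvgrPdist_lt => e e0.
near=> n; have fgn : `|f n - l| <= g n by near: n.
have gn : `|0 - g n| < e by near: n; exact: (cvgr_dist_lt _ _ g0 _ e0).
rewrite sub0r normrN in gn.
rewrite distrC; apply: le_lt_trans (fgn) (le_lt_trans _ gn).
(* The values of [g] are complex; that [g n] is real follows from its lying above a norm. *)
by rewrite real_ler_norm // ger0_real // (le_trans _ fgn).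
Unshelve. all: by end_near. Qed.

Lemma cvg_normB0 (V : normedModType C) (f : T -> V) (l : V) :
  f @ F --> l -> (fun n => `|f n - l|) @ F --> (0 : Co).
Proof.
move=> fl; rewrite -(@normr0 _ V) -(subrr l); apply: cvg_norm.
by apply: cvgB => //; exact: cvg_cst.
Qed.

Lemma cvgDC (f g : T -> Co) (a b : Co) : f @ F --> a -> g @ F --> b ->
  (fun n => (f n + g n : Co)) @ F --> (a + b : Co).
Proof. exact: (@cvgD C Co T F _ f g a b). Qed.

Lemma cvgMC (f g : T -> Co) (a b : Co) : f @ F --> a -> g @ F --> b ->
  (fun n => (f n * g n : Co)) @ F --> (a * b : Co).
Proof. exact: (@cvgM C T F _ f g a b). Qed.

Lemma cvg_ip (u v : T -> H) a b : u @ F --> a -> v @ F --> b ->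
  (fun n => ip (u n) (v n)) @ F --> (ip a b : Co).
Proof.
move=> ua vb.
apply: (@cvg_dominated Co _ _ (fun n => `|u n - a| * `|v n - b| +
  (`|u n - a| * `|b| + `|a| * `|v n - b|))).
  near=> n; have -> : ip (u n) (v n) - ip a b = ip (u n - a) (v n - b) +
      (ip (u n - a) b + ip a (v n - b)).
    by rewrite !ipBl !ipBr; ring.
  apply: le_trans (ler_normD _ _) _; apply: lerD (cauchy_schwarz ip_norm _ _) _.
  apply: le_trans (ler_normD _ _) _.
  by apply: lerD; apply: (cauchy_schwarz ip_norm).
rewrite [X in _ --> X](_ : _ = 0 * 0 + (0 * `|b| + `|a| * 0) :> Co); last first.
  by rewrite !mul0r mulr0 !addr0.
have u0 := cvg_normB0 ua; have v0 := cvg_normB0 vb.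
apply: cvgDC; first exact: cvgMC u0 v0.
apply: cvgDC; first exact: cvgMC u0 (cvg_cst _).
exact: cvgMC (cvg_cst _) v0.
Unshelve. all: by end_near. Qed.

Lemma cvg_sum_seq (V : normedModType C) I (s : seq I) (f : I -> T -> V) l :
  (forall i, f i @ F --> l i) ->
  (fun n => \sum_(i <- s) f i n) @ F --> \sum_(i <- s) l i.
Proof. by move=> fl; apply: cvg_big => //; exact: add_continuous. Qed.

Lemma cvg_lincomb (I : finType) (c : T -> I -> Co) (d : I -> C) (b : I -> H) :
  (forall i, (fun n => c n i) @ F --> (d i : Co)) ->
  (fun n => \sum_i c n i *: b i) @ F --> \sum_i d i *: b i.
Proof.
move=> cd; apply: cvg_sum_seq => i; apply: cvgZ; [exact: cd|exact: cvg_cst].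
Qed.

Lemma cvg_uniq (V : normedModType C) (f : T -> V) (l l' : V) :
  f @ F --> l -> f @ F --> l' -> l = l'.
Proof. exact: (@cvg_unique _ (@norm_hausdorff _ V) (f @ F)). Qed.

Lemma norm_lim_le (V : normedModType C) (f : T -> V) (l : V) (M : C) :
  (\forall n \near F, `|f n| <= M) -> f @ F --> l -> `|l| <= M.
Proof.
move=> fM fl; apply/ler_addgt0Pr => e e0.
have /cvgrPdist_lt/(_ e e0) H1 := fl.
have [n [le1 le2]] := filter_ex (filterI fM H1).
rewrite -(subrK (f n) l) addrC.
by apply: le_trans (ler_normD _ _) _; apply: lerD => //; apply: ltW.
Qed.

End Limits.

Section BoundedOperators.
Context {R : realType} {H : completeNormedModType R[i]}.
Context {ip : {dot H for @Num.conj R[i]}}.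
Context (ip_norm : forall v : H, ip v v = `|v| ^+ 2).
Local Notation C := R[i].

(** The constant in [bounded_op] is any element of [R[i]], but a nonzero vector forces it to be real
    and nonnegative; its modulus therefore always works. *)
Lemma bounded_opP (T : H -> H) : bounded_op T ->
  linear T /\ exists2 M : C, 0 <= M & forall v, `|T v| <= M * `|v|.
Proof.
move=> [lT [M TM]]; split=> //; exists `|M| => // v.
apply: le_trans (TM v) _.
have [->|v0] := eqVneq v 0; first by rewrite normr0 !mulr0.
have vp : 0 < `|v| by rewrite normr_gt0.
apply: ler_wpM2r => //; rewrite real_ler_norm //.
by rewrite ger0_real // -(pmulr_lge0 _ vp) (le_trans _ (TM v)).
Qed.

Lemma linear_opD (T : H -> H) u v : linear T -> T (u + v) = T u + T v.
Proof. by move=> lT; have := lT 1 u v; rewrite !scale1r. Qed.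

Lemma linear_op0 (T : H -> H) : linear T -> T 0 = 0.
Proof. by move=> lT; apply: (addrI (T 0)); rewrite -linear_opD // !addr0. Qed.

Lemma linear_opZ (T : H -> H) a u : linear T -> T (a *: u) = a *: T u.
Proof. by move=> lT; rewrite -[a *: u]addr0 lT linear_op0 // addr0. Qed.

Lemma linear_opB (T : H -> H) u v : linear T -> T (u - v) = T u - T v.
Proof. by move=> lT; rewrite linear_opD // -scaleN1r linear_opZ // scaleN1r. Qed.

Lemma linear_op_sum (T : H -> H) I (s : seq I) P (f : I -> H) : linear T ->
  T (\sum_(i <- s | P i) f i) = \sum_(i <- s | P i) T (f i).
Proof.
move=> lT; apply: (big_morph T) => [u v|]; first exact: linear_opD.
exact: linear_op0.
Qed.

Lemma isometry_norm V v : isometry_op ip V -> `|V v| = `|v|.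
Proof.
by move=> [_ iV]; apply/eqP; rewrite -(@eqrXn2 _ 2) // -!ip_norm iV.
Qed.

Lemma isometry_bounded V : isometry_op ip V -> bounded_op V.
Proof.
move=> iV; split; first by case: iV.
by exists 1 => v; rewrite mul1r isometry_norm.
Qed.

Lemma cvg_bounded_op {T : Type} {F : set_system T} {FF : ProperFilter F}
  (S : H -> H) (u : T -> H) a :
  bounded_op S -> u @ F --> a -> (fun n => S (u n)) @ F --> S a.
Proof.
move=> /bounded_opP[lS [M M0 SM]] ua.
apply: (@cvg_dominated _ _ _ _ _ _ _ (fun n => M * `|u n - a|)).
  by near=> n; rewrite -linear_opB.
rewrite -(mulr0 M); apply: cvgMC; first exact: cvg_cst.
exact: cvg_normB0.
Unshelve. all: by end_near. Qed.

Lemma bounded_op_comp S T : bounded_op S -> bounded_op T ->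
  bounded_op (fun v : H => S (T v)).
Proof.
move=> /bounded_opP[lS [M M0 SM]] /bounded_opP[lT [N N0 TN]]; split.
  by move=> a u v; rewrite lT lS.
exists (M * N) => v; apply: le_trans (SM _) _.
by rewrite -mulrA; apply: ler_wpM2l.
Qed.

Lemma bounded_op_id : bounded_op (fun v : H => v).
Proof. by split=> //; exists 1 => v; rewrite mul1r. Qed.

Lemma bounded_op_scale a S : bounded_op S -> bounded_op (fun v : H => a *: S v).
Proof.
move=> /bounded_opP[lS [M M0 SM]]; split.
  by move=> b u v; rewrite lS scalerDr !scalerA mulrC.
by exists (`|a| * M) => v; rewrite normrZ -mulrA; apply: ler_wpM2l.
Qed.

Lemma bounded_op_add S T : bounded_op S -> bounded_op T ->
  bounded_op (fun v : H => S v + T v).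
Proof.
move=> /bounded_opP[lS [M M0 SM]] /bounded_opP[lT [N N0 TN]]; split.
  by move=> a u v; rewrite lT lS scalerDr addrACA.
exists (M + N) => v; apply: le_trans (ler_normD _ _) _.
by rewrite mulrDl; apply: lerD.
Qed.

Lemma bounded_op_sum I (s : seq I) P (S : I -> H -> H) :
  (forall i, bounded_op (S i)) ->
  bounded_op (fun v : H => \sum_(i <- s | P i) S i v).
Proof.
move=> bS; elim: s => [|i s IH].
  under [X in bounded_op X]eq_fun do rewrite big_nil.
  split; first by move=> a u v; rewrite scaler0 addr0.
  by exists 0 => v; rewrite normr0 mul0r.
under [X in bounded_op X]eq_fun do rewrite big_cons.
by case: (P i) => //; apply: bounded_op_add.
Qed.

End BoundedOperators.

(** * Orthonormal bases *)

Definition oproj_nat {R : realType} {H : completeNormedModType R[i]}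
    (ip : {dot H for @Num.conj R[i]}) (e : nat -> H) n : H -> H :=
  oproj ip (fun i : 'I_n => e i).

Definition orthonormal_basis {R : realType} {H : completeNormedModType R[i]}
    (ip : {dot H for @Num.conj R[i]}) (e : nat -> H) : Prop :=
  orthonormal_family ip e /\ forall v, (fun n => oproj_nat ip e n v) @ \oo --> v.

Lemma orthonormal_sub {R : realType} {H : completeNormedModType R[i]}
    {ip : {dot H for @Num.conj R[i]}} (I J : eqType) (e : J -> H) (f : I -> J) :
  injective f -> orthonormal_family ip e ->
  orthonormal_family ip (fun i => e (f i)).
Proof. by move=> fi oe i j; rewrite oe (inj_eq fi). Qed.

Lemma orthonormal_ord {R : realType} {H : completeNormedModType R[i]}
    {ip : {dot H for @Num.conj R[i]}} (e : nat -> H) n :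
  orthonormal_family ip e -> orthonormal_family ip (fun i : 'I_n => e i).
Proof. exact/orthonormal_sub/val_inj. Qed.

(** Orthonormalise a dense sequence [d]: [d k] lies in the span of the first [k.+1] vectors, so by
    best approximation every later projection of [v] is at least as close to [v] as [d k]. *)
Lemma exists_orthonormal_basis {R : realType} {H : completeNormedModType R[i]}
    {ip : {dot H for @Num.conj R[i]}}
    (ip_norm : forall v : H, ip v v = `|v| ^+ 2)
    (H_separable : separable_space H) (H_infinite : infinite_dimensional H) :
  exists e : nat -> H, orthonormal_basis ip e.
Proof.
have [D /countable_injP[f finj] dD] := H_separable.
(* [d] inverts the injection [f] of [D] into the integers, with value 0 at indices that [f]
   misses. *)
pose d n := xget 0 [set v | D v /\ f v = n].
have dE v : D v -> d (f v) = v.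
  move=> Dv; rewrite /d; case: xgetP => [w _ [Dw fw]|/(_ v)[]//].
  by apply: finj => //; rewrite inE.
have [e oe eE] := adaptive_gram_schmidt ip_norm H_infinite (fun s => d (size s)).
have {}eE k : d k = oproj_nat ip e k.+1 (d k) by have := eE k; rewrite size_mkseq.
exists e; split=> // v; apply/cvgrPdist_lt => eps eps0.
have [|x [/= vd Dx]] := dD (ball v eps) _ (ball_open v eps).
  by exists v; exact: ballxx.
move: vd; rewrite -(dE _ Dx); set k := f _; rewrite -ball_normE /= => vd.
exists k.+1 => // n /= kn; apply: le_lt_trans vd.
rewrite eE /oproj_nat /oproj (big_ord_widen n (fun i => ip (d k) (e i) *: e i)) //.
have -> : \sum_(i < n | (i < k.+1)%N) ip (d k) (e i) *: e i =
    \sum_(i < n) (if (i < k.+1)%N then ip (d k) (e i) else 0) *: e i.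
  by rewrite big_mkcond; apply: eq_bigr => i _; case: ifP; rewrite // scale0r.
exact: oproj_best (orthonormal_ord oe).
Qed.

Section Basis.
Context {R : realType} {H : completeNormedModType R[i]}.
Context {ip : {dot H for @Num.conj R[i]}}.
Context (ip_norm : forall v : H, ip v v = `|v| ^+ 2).
Context {e : nat -> H} (be : orthonormal_basis ip e).
Local Notation C := R[i].

Let oe : orthonormal_family ip e := be.1.
Let eo n : orthonormal_family ip (fun i : 'I_n => e i) := orthonormal_ord oe.
Let ce v : (fun n => oproj_nat ip e n v) @ \oo --> v := be.2 v.

Lemma basis_extl u v : (forall i, ip u (e i) = ip v (e i)) -> u = v.
Proof.
move=> uv.
apply: (cvg_uniq (@ce u)).
have -> : (fun n => oproj_nat ip e n u) = (fun n => oproj_nat ip e n v).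
  by apply/funext => n; apply: eq_bigr => i _; rewrite uv.
exact: ce.
Qed.

Lemma basis_eq_op S T : bounded_op S -> bounded_op T ->
  (forall i, S (e i) = T (e i)) -> S = T.
Proof.
move=> bS bT ST; apply/funext => v.
apply: (cvg_uniq (cvg_bounded_op bS (@ce v))).
have -> : (fun n => S (oproj_nat ip e n v)) = (fun n => T (oproj_nat ip e n v)).
  apply/funext => n; have [lS _] := bS; have [lT _] := bT.
  rewrite (linear_op_sum _ _ _ lS) (linear_op_sum _ _ _ lT).
  by apply: eq_bigr => i _; rewrite (linear_opZ _ _ lS) (linear_opZ _ _ lT) ST.
exact: (cvg_bounded_op bT (@ce v)).
Qed.

Section Extension.
Context {T : Type} {F : set_system T} {FF : ProperFilter F}.
Context (S : T -> H -> H) (M : C) (M0 : 0 <= M).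
Context (lS : forall n, linear (S n)) (SM : forall n v, `|S n v| <= M * `|v|).
Context (Se : forall i, cvg (S n (e i) @[n --> F])).

(** The uniform bound [M] transfers convergence from the basis to [v]: approximate [v] by a finite
    combination [w], on which the limit [z] exists, and use [z] as centre in the Cauchy
    criterion. *)
Lemma pointwise_cvg_of_basis v : cvg (S n v @[n --> F]).
Proof.
apply/cauchy_cvgP/cauchy_exP => eps eps0.
have M1 : 0 < M + 1 by apply: ltr_wpDl.
(* Division by [M + 1] rather than [M] covers the case where [M] is zero. *)
have d0 : 0 < eps / 2 / (M + 1) by rewrite divr_gt0 // divr_gt0.
have [n _ /(_ n (leqnn _))] := cvgr_dist_lt _ _ (@ce v) _ d0.
set w := oproj_nat _ _ _ _ => vw.
have [z Sz] : exists z : H, S m w @[m --> F] --> z.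
  have /choice[z Sz] : forall i, exists z : H, S m (e i) @[m --> F] --> z.
    by move=> i; exists (lim (S m (e i) @[m --> F])); exact: Se.
  exists (\sum_(i < n) ip v (e i) *: z i).
  have -> : (fun m => S m w) =
      (fun m => \sum_(i < n) ip v (e i) *: S m (e i)).
    apply/funext => m; rewrite (linear_op_sum _ _ _ (lS m)).
    by apply: eq_bigr => i _; rewrite (linear_opZ _ _ (lS m)).
  by apply: cvg_sum_seq => i; apply: cvgZ; [exact: cvg_cst|exact: Sz].
exists z; suff : \forall m \near F, ball z eps (S m v) by [].
near=> m; rewrite -ball_normE /=.
rewrite -(subrK (S m w) z) -addrA (splitr eps).
apply: le_lt_trans (ler_normD _ _) _; apply: ltr_leD.
  near: m; apply: (cvgr_dist_lt _ _ Sz); exact: divr_gt0.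
rewrite -(linear_opB _ _ (lS m)); apply: le_trans (SM _ _) _.
rewrite distrC in vw; apply: le_trans (ler_wpM2l M0 (ltW vw)) _.
rewrite mulrA ler_pdivrMr // [leRHS]mulrC ler_wpM2r ?lerDl ?ler01 //.
by rewrite ltW // divr_gt0.
Unshelve. all: by end_near. Qed.

Definition limit_op (v : H) : H := lim (S n v @[n --> F]).

Lemma limit_opP v : S n v @[n --> F] --> limit_op v.
Proof. exact: pointwise_cvg_of_basis. Qed.

Lemma limit_op_linear : linear limit_op.
Proof.
move=> a u v; apply: (cvg_uniq (@limit_opP _)).
have -> : (fun n => S n (a *: u + v)) = (fun n => a *: S n u + S n v).
  by apply/funext => n; rewrite lS.
apply: cvgD; last exact: limit_opP.
by apply: cvgZ; [exact: cvg_cst|exact: limit_opP].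
Qed.

Lemma limit_op_norm v : `|limit_op v| <= M * `|v|.
Proof.
by apply: norm_lim_le (@limit_opP v); apply: nearW => n; exact: SM.
Qed.

Lemma limit_op_bounded : bounded_op limit_op.
Proof. by split; [exact: limit_op_linear|exists M; exact: limit_op_norm]. Qed.

End Extension.
End Basis.

Lemma Re_le (R : realType) (x y : R[i]) :
  x <= y -> complex.Re x <= complex.Re y.
Proof. by rewrite lecE => /andP[]. Qed.

(** * Isometries from orthonormal sequences, the Riesz theorem and adjoints *)

Section Adjoint.
Context {R : realType} {H : completeNormedModType R[i]}.
Context {ip : {dot H for @Num.conj R[i]}}.
Context (ip_norm : forall v : H, ip v v = `|v| ^+ 2).
Context {e : nat -> H} (be : orthonormal_basis ip e).
Local Notation C := R[i].
Local Notation Co := (R[i]^o).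

Let oe : orthonormal_family ip e := be.1.
Let eo n : orthonormal_family ip (fun i : 'I_n => e i) := orthonormal_ord oe.
Let ce v : (fun n => oproj_nat ip e n v) @ \oo --> v := be.2 v.

(** [V] is the strong limit of the contractions [S n], which are eventually constant on each basis
    vector; inner products of the [S n] are those of the basis projections and pass to the limit. *)
Lemma isometry_of_families (b : nat -> H) : orthonormal_family ip b ->
  exists2 V, isometry_op ip V & forall i, V (e i) = b i.
Proof.
move=> ob; pose S n v := \sum_(i < n) ip v (e i) *: b i.
have lS n : linear (S n).
  move=> a u v; rewrite /S scaler_sumr -big_split; apply: eq_bigr => i _ /=.
  by rewrite ipDl ipZl scalerDl scalerA.
have ipS n u v : ip (S n u) (S n v) = ip (oproj_nat ip e n u) (oproj_nat ip e n v).
  by rewrite !ip_lincomb //; exact: orthonormal_ord.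
have SM n v : `|S n v| <= 1 * `|v|.
  rewrite mul1r; apply: le_trans _ (norm_oproj ip_norm v (@eo n)).
  by rewrite -(ler_sqr_norm ip_norm) ipS.
have Se i : S n (e i) @[n --> \oo] --> b i.
  apply: cvg_near_cst; exists i.+1 => // n /= ilt.
  rewrite /S (bigD1 (Ordinal ilt)) //= big1 => [|j ji].
    by rewrite oe eqxx scale1r addr0.
  by rewrite oe -[_ == _]/(Ordinal ilt == j) eq_sym (negbTE ji) scale0r.
pose proof (limit_opP be ler01 lS SM (fun i => cvgP _ (@Se i))) as SP.
exists (limit_op S (F := \oo)); last first.
  by move=> i; exact: (cvg_uniq (@SP _) (@Se i)).
split; first exact: (limit_op_linear be ler01 lS SM (fun i => cvgP _ (@Se i))).
move=> u v; apply: (cvg_uniq (cvg_ip ip_norm (@SP u) (@SP v))).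
have -> : (fun n => ip (S n u) (S n v) : Co) =
    (fun n => ip (oproj_nat ip e n u) (oproj_nat ip e n v)).
  by apply/funext => n; rewrite ipS.
exact: (cvg_ip ip_norm (@ce u) (@ce v)).
Qed.

(* Riesz: the partial sums of the candidate vector have nondecreasing bounded
   norms, so they form a Cauchy sequence. *)
Lemma adjoint_exists (T : H -> H) v : bounded_op T ->
  exists w, forall u, ip (T u) v = ip u w.
Proof.
move=> bT; have [lT [M M0 TM]] := bounded_opP bT.
pose phi u := ip (T u) v.
have phiS n (c : nat -> C) :
    phi (\sum_(i < n) c i *: e i) = \sum_(i < n) c i * phi (e i).
  rewrite /phi (linear_op_sum _ _ _ lT) ip_suml; apply: eq_bigr => i _.
  by rewrite (linear_opZ _ _ lT) ipZl.
pose w n := \sum_(i < n) (phi (e i))^* *: e i.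
have ipw n : ip (w n) (w n) = \sum_(i < n) `|phi (e i)| ^+ 2.
  rewrite /w ip_lincomb //; apply: eq_bigr => i _.
  by rewrite conjCK mulrC normCK.
pose s n : R := \sum_(i < n) complex.Re (`|phi (e i)| ^+ 2).
have sE n : ip (w n) (w n) = (s n)%:C.
  rewrite ipw rmorph_sum; apply: eq_bigr => i _.
  by apply/esym/RRe_real; rewrite realX // normr_real.
(* [phi (w n)] is the squared norm of [w n]; comparing it with the bound on [phi] and cancelling one
   factor bounds the norms uniformly in [n]. *)
have wM n : `|w n| <= M * `|v|.
  have [->|w0] := eqVneq (w n) 0; first by rewrite normr0 mulr_ge0.
  have wp : 0 < `|w n| by rewrite normr_gt0.
  rewrite -(ler_pM2l wp) -expr2 -ip_norm ipw.
  have -> : \sum_(i < n) `|phi (e i)| ^+ 2 = phi (w n).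
    rewrite (phiS n (fun i => (phi (e i))^*)); apply: eq_bigr => i _.
    by rewrite mulrC normCK.
  have phi0 : 0 <= phi (w n).
    rewrite (phiS n (fun i => (phi (e i))^*)); apply: sumr_ge0 => i _.
    by rewrite mulrC mul_conjC_ge0.
  rewrite -(ger0_norm phi0); apply: le_trans (cauchy_schwarz ip_norm _ _) _.
  by rewrite mulrA [in leRHS](mulrC `|w n|) ler_wpM2r.
have snd : nondecreasing_seq s.
  apply/nondecreasing_seqP => n; rewrite /s big_ord_recr lerDl.
  by apply: (Re_le (x := 0)); rewrite exprn_ge0.
have sub : has_ubound (range s).
  exists (complex.Re ((M * `|v|) ^+ 2)) => _ [n _ <-].
  apply: (@Re_le _ (s n)%:C).
  by rewrite -sE ip_norm ler_sqr ?nnegrE ?mulr_ge0.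
have wj m j : (j < m)%N -> ip (w m) (e j) = (phi (e j))^*.
  move=> jm; rewrite -[e j]/(e (Ordinal jm)).
  exact: (ip_lincombl (b := fun i : 'I_m => e i)).
have wdiff m n : (n <= m)%N -> ip (w m - w n) (w m - w n) = (s m - s n)%:C.
  move=> nm; have wmn : ip (w m) (w n) = ip (w n) (w n).
    rewrite {2 4}/w !ip_sumr; apply: eq_bigr => j _; rewrite !ipZr !wj //.
    exact: leq_trans (ltn_ord j) nm.
  rewrite ipBl !ipBr (ipC (w n)) wmn -ipC subrr subr0 !sE.
  by rewrite rmorphB.
have cw : cvg (w @ \oo).
  apply/cauchy_cvgP/cauchy_exP => eps eps0.
  have epsE : eps = (complex.Re eps)%:C by rewrite RRe_real // gtr0_real.
  have r0 : 0 < complex.Re eps by rewrite -ltcR -epsE.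
  have r20 : 0 < (complex.Re eps) ^+ 2 by rewrite exprn_gt0.
  have := nondecreasing_cvgn snd sub.
  move=> /cvgrPdist_lt/(_ _ r20)[n _ /(_ n (leqnn _)) /= sn].
  exists (w n); exists n => // m /= nm; rewrite -ball_normE /= distrC.
  rewrite -(@ltr_pXn2r _ 2) ?nnegrE ?(ltW eps0) // -ip_norm wdiff //.
  rewrite epsE -rmorphXn ltcR; apply: le_lt_trans sn.
  apply: le_trans (ler_norm _); rewrite lerD2r.
  by apply: ub_le_sup => //; exists m.
exists (lim (w @ \oo)).
have phiE i : ip (e i) (lim (w @ \oo)) = phi (e i).
  pose proof (cvg_ip ip_norm (cvg_cst (e i)) cw) as ciw.
  apply: (cvg_uniq ciw); apply: cvg_near_cst.
  by exists i.+1 => // n /= ilt; rewrite ipC wj // conjCK.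
move=> u.
pose proof (cvg_ip ip_norm (cvg_bounded_op bT (@ce u))
  (cvg_cst v)) as cT.
pose proof (cvg_ip ip_norm (@ce u)
  (cvg_cst (lim (w @ \oo)))) as cu.
apply: (cvg_uniq cT).
suff -> : (fun n => ip (T (oproj_nat ip e n u)) v : Co) =
    (fun n => ip (oproj_nat ip e n u) (lim (w @ \oo))) by [].
apply/funext => n; rewrite -/(phi _) (phiS n (fun i => ip u (e i))) ip_suml.
by apply: eq_bigr => i _; rewrite ipZl phiE.
Qed.

Lemma adjointP (T : H -> H) u v : bounded_op T ->
  ip (T u) v = ip u (adjoint ip T v).
Proof.
move=> bT; have [w wP] := adjoint_exists v bT.
by rewrite /adjoint; case: xgetP => [x _ -> //|/(_ w)].
Qed.

Lemma adjoint_bounded (T : H -> H) : bounded_op T -> bounded_op (adjoint ip T).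
Proof.
move=> bT; split.
  move=> a u v; apply: (@ip_extr _ _ ip) => w.
  by rewrite -adjointP // !ipDr !ipZr -!adjointP.
have [_ [M M0 TM]] := bounded_opP bT; exists M => v.
set w := adjoint ip T v.
have [->|w0] := eqVneq w 0; first by rewrite normr0 mulr_ge0.
have wp : 0 < `|w| by rewrite normr_gt0.
rewrite -(ler_pM2l wp) -expr2 -ip_norm {2}/w -adjointP //.
rewrite -[leLHS]ger0_norm; last by rewrite adjointP // ip_ge0.
apply: le_trans (cauchy_schwarz ip_norm _ _) _.
by rewrite mulrA [in leRHS](mulrC `|w|) ler_wpM2r.
Qed.

Lemma isometry_adjointK V v : isometry_op ip V -> adjoint ip V (V v) = v.
Proof.
move=> iV; apply: (@ip_extr _ _ ip) => u.
by rewrite -adjointP ?iV.2 //; exact: isometry_bounded.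
Qed.

Lemma sa_tuple_compress g (X : 'I_g -> H -> H) V : sa_tuple ip X ->
  isometry_op ip V -> sa_tuple ip (compress ip V X).
Proof.
move=> saX iV j; have [bX sX] := saX j; have bV := isometry_bounded ip_norm iV.
split.
  exact: bounded_op_comp (adjoint_bounded bV) (bounded_op_comp bX bV).
move=> u v; rewrite /compress -adjointP // ipC -adjointP // -ipC.
exact: sX.
Qed.

End Adjoint.

(** * Evaluation of free polynomials *)

Section PolyEval.
Context {R : realType} {H : completeNormedModType R[i]} {g : nat}.
Local Notation C := R[i].
Implicit Types (p q : free_poly C g) (X : 'I_g -> H -> H).

(** Two polynomials can be added termwise only over a common index set containing both supports. *)
Lemma poly_eval_widen (d : {fset {fmonom 'I_g}}) p X (v : H) :
  (msupp p `<=` d)%fset ->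
  poly_eval p X v = \sum_(w <- d) p@_w *: word_eval X w v.
Proof.
move=> le; rewrite [LHS](big_fset_incl _ le) => //= w wd /mcoeff_outdom ->.
by rewrite scale0r.
Qed.

Lemma poly_eval0 X v : poly_eval (0 : free_poly C g) X v = 0.
Proof. by rewrite /poly_eval msupp0 big_seq_fset0. Qed.

Lemma poly_evalD p q X v :
  poly_eval (p + q) X v = poly_eval p X v + poly_eval q X v.
Proof.
rewrite (poly_eval_widen X v (msuppD_le p q)).
rewrite (poly_eval_widen X v (fsubsetUl _ (msupp q))).
rewrite (poly_eval_widen (p := q) X v (fsubsetUr (msupp p) _)) -big_split /=.
by apply: eq_bigr => w _; rewrite mcoeffD scalerDl.
Qed.

Lemma poly_evalU c w X v :
  poly_eval (<< c *g w >> : free_poly C g) X v = c *: word_eval X w v.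
Proof.
by rewrite (poly_eval_widen X v msuppU_le) big_seq_fset1 mcoeffUU.
Qed.

Lemma poly_eval_fvar j X : poly_eval (fvar j) X = X j.
Proof.
by apply/funext => v; rewrite /fvar poly_evalU scale1r fmuE.
Qed.

Lemma poly_eval_fstar p X v : poly_eval (fstar p) X v =
  \sum_(w <- msupp p) Num.conj p@_w *: word_eval X (rev w) v.
Proof.
rewrite /fstar (big_morph (fun q => poly_eval q X v)
  (fun p q => poly_evalD p q X v) (poly_eval0 X v)).
by apply: eq_bigr => w _; rewrite poly_evalU.
Qed.

Lemma word_eval_bounded X w : (forall j, bounded_op (X j)) ->
  bounded_op (word_eval X w).
Proof.
move=> bX; elim: w => [|j w IH]; first exact: bounded_op_id.
exact: (bounded_op_comp (bX j) IH).
Qed.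

Lemma poly_eval_bounded p X : (forall j, bounded_op (X j)) ->
  bounded_op (poly_eval p X).
Proof.
move=> bX; apply: bounded_op_sum => w; apply: bounded_op_scale.
exact: word_eval_bounded.
Qed.

Lemma word_eval_intertwine X X' V w v :
  (forall j u, V (X' j u) = X j (V u)) ->
  V (word_eval X' w v) = word_eval X w (V v).
Proof. by move=> VX; elim: w => //= j w IH; rewrite VX IH. Qed.

(** Applied both to isometries onto reducing subspaces and to the coordinate maps of a direct
    sum. *)
Lemma poly_eval_intertwine p X X' V v : linear V ->
  (forall j u, V (X' j u) = X j (V u)) ->
  V (poly_eval p X' v) = poly_eval p X (V v).
Proof.
move=> lV VX; rewrite (linear_op_sum _ _ _ lV); apply: eq_bigr => w _.
by rewrite (linear_opZ _ _ lV) (word_eval_intertwine _ _ VX).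
Qed.

Section SelfAdjoint.
Context {ip : {dot H for @Num.conj R[i]}}.

Lemma word_eval_adjoint X w u v : (forall j, selfadjoint ip (X j)) ->
  ip (word_eval X w u) v = ip u (word_eval X (rev w) v).
Proof.
move=> sX; elim: w v => //= j w IH v; rewrite sX IH.
by rewrite rev_cons -cats1 /word_eval foldr_cat.
Qed.

Lemma poly_eval_selfadjoint p X : (forall j, selfadjoint ip (X j)) ->
  fsymmetric p -> selfadjoint ip (poly_eval p X).
Proof.
move=> sX sp u v; rewrite -{2}sp poly_eval_fstar ip_suml ip_sumr.
apply: eq_bigr => w _.
by rewrite ipZl ipZr conjCK (word_eval_adjoint _ _ _ sX).
Qed.

Lemma tuple_eval_sa r (Gam : 'I_r -> free_poly C g) X :
  (forall j, fsymmetric (Gam j)) -> sa_tuple ip X ->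
  sa_tuple ip (tuple_eval Gam X).
Proof.
move=> sG saX j; split.
  by apply: poly_eval_bounded => i; case: (saX i).
by apply: poly_eval_selfadjoint => // i; case: (saX i).
Qed.

End SelfAdjoint.

Section Limit.
Context {T : Type} {F : set_system T} {FF : ProperFilter F}.
Context (X : T -> 'I_g -> H -> H) (Y : 'I_g -> H -> H) (M : C).
Context (lX : forall n j, linear (X n j)).
Context (XM : forall n j v, `|X n j v| <= M * `|v|).
Context (XY : forall j v, X n j v @[n --> F] --> Y j v).

(** Operator application is jointly continuous for strong convergence only on bounded sets; [M]
    controls the error from replacing [u n] by [a]. Words, hence polynomials, then converge. *)
Lemma cvg_op_apply (u : T -> H) a j :
  u @ F --> a -> X n j (u n) @[n --> F] --> Y j a.
Proof.
move=> ua; have -> : (fun n => X n j (u n)) =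
    (fun n => X n j (u n - a) + X n j a).
  by apply/funext => n; rewrite -linear_opD // subrK.
rewrite -[Y j a]add0r; apply: cvgD; last exact: XY.
apply: (cvg_dominated (g := fun n => M * `|u n - a|)).
  by near=> n; rewrite subr0.
rewrite -(mulr0 M); apply: cvgMC; first exact: cvg_cst.
exact: cvg_normB0.
Unshelve. all: by end_near. Qed.

Lemma cvg_word_eval w (u : T -> H) a : u @ F --> a ->
  word_eval (X n) w (u n) @[n --> F] --> word_eval Y w a.
Proof.
by move=> ua; elim: w => //= j w IH; apply: (cvg_op_apply IH).
Qed.

Lemma cvg_poly_eval p (u : T -> H) a : u @ F --> a ->
  poly_eval p (X n) (u n) @[n --> F] --> poly_eval p Y a.
Proof.
move=> ua; apply: cvg_sum_seq => w; apply: cvgZ; first exact: cvg_cst.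
exact: cvg_word_eval.
Qed.

End Limit.
End PolyEval.

(** * Ultralimits of elements of a Gamma-convex set *)

Section Ultralimits.
Context {R : realType} {T : Type} {U : set_system T} {UU : UltraFilter U}.
Local Notation C := R[i].
Local Notation Co := (R[i]^o).

(** Compactness gives a cluster point, and a cluster point of an ultrafilter is a limit: either the
    preimage of a neighbourhood or its complement belongs to [U]. *)
Lemma ultra_cvg_compact (V : topologicalType) (A : set V) (u : T -> V) :
  compact A -> (\forall n \near U, A (u n)) -> exists l : V, u @ U --> l.
Proof.
move=> cA uA; have [p [_ clp]] := cA (u @ U) _ uA; exists p => B nB.
have [//|nUB] := in_ultra_setVsetC (u @^-1` B) UU.
by have [x [nBx Bx]] := clp (~` B) B nUB nB; case: (nBx Bx).
Qed.

Lemma ultra_cvg_real (u : T -> R) M :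
  (\forall n \near U, `|u n| <= M) -> exists l : R, u @ U --> l.
Proof.
move=> uM; apply: (ultra_cvg_compact (@segment_compact R (- M) M)).
near=> n; rewrite /= in_itv /= -ler_norml; near: n.
exact: uM.
Unshelve. all: by end_near. Qed.

Lemma cvg_real_complex (u : T -> R) (a : R) : u @ U --> a ->
  (fun n => (u n)%:C : Co) @ U --> (a%:C : Co).
Proof.
move=> ua; apply/cvgrPdist_lt => eps eps0.
have epsE : eps = (complex.Re eps)%:C by rewrite RRe_real // gtr0_real.
have r0 : 0 < complex.Re eps by rewrite -ltcR -epsE.
have /cvgrPdist_lt/(_ _ r0) := ua; apply: filterS => n un.
rewrite -(rmorphB (real_complex R)) normc_def /= expr0n /= addr0 sqrtr_sqr.
by rewrite epsE ltcR.
Qed.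

Lemma ultra_cvg_complex (u : T -> Co) (M : C) :
  (\forall n \near U, `|u n| <= M) -> exists l : Co, u @ U --> l.
Proof.
move=> uM.
have Re_M (z : C) : `|z| <= M -> `|complex.Re z| <= complex.Re M.
  by move=> zM; apply: (Re_le (le_trans (normc_ge_Re z) zM)).
(* Multiplication by the imaginary unit reduces the imaginary part to the real one. *)
have Im_M (z : C) : `|z| <= M -> `|complex.Im z| <= complex.Re M.
  move=> zM; have := Re_M (z * 'i%C); rewrite ReiNIm normrN; apply.
  by rewrite normrM complexiE normCi mulr1.
have [a ua] : exists a : R, (fun n => complex.Re (u n)) @ U --> a.
  by apply: (@ultra_cvg_real _ (complex.Re M)); apply: filterS uM => n; exact: Re_M.
have [b ub] : exists b : R, (fun n => complex.Im (u n)) @ U --> b.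
  by apply: (@ultra_cvg_real _ (complex.Re M)); apply: filterS uM => n; exact: Im_M.
exists (a%:C + 'i%C * b%:C : Co).
rewrite (_ : u = fun n => (complex.Re (u n))%:C + 'i%C * (complex.Im (u n))%:C).
  apply: cvgDC; first exact: cvg_real_complex.
  by apply: cvgMC; [exact: cvg_cst|exact: cvg_real_complex].
by apply/funext => n; exact: complexE.
Qed.

End Ultralimits.

Lemma sot_closed_limit {R : realType} {H : completeNormedModType R[i]}
    (ip : {dot H for @Num.conj R[i]}) g (K : set ('I_g -> H -> H))
    {T : Type} {F : set_system T} {FF : ProperFilter F}
    (X : T -> 'I_g -> H -> H) (Y : 'I_g -> H -> H) :
  sot_closed ip K -> (forall n, K (X n)) ->
  (forall j v, X n j v @[n --> F] --> Y j v) -> sa_tuple ip Y -> K Y.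
Proof.
move=> clK KX XY saY; apply: clK; split => // B nB.
suff XB : F (X @^-1` B).
  by have [n Bn] := filter_ex XB; exists (X n).
(* The topology is a pointwise one nested in another, so this is used twice: for the index of the
   tuple and for the vector. *)
have ptws_cvg (I : Type) (V : topologicalType) (Z : T -> I -> V) z :
    (forall i, Z n i @[n --> F] --> z i) ->
    (Z : T -> {ptws I -> V}) @ F --> (z : {ptws I -> V}).
  move=> Zz; apply/cvg_sup => i A [A' [[B' oB' <-] B'z] sA].
  by apply: filterS sA _; apply: Zz; exact: open_nbhs_nbhs.
apply: (@ptws_cvg 'I_g {ptws H -> H} X Y) nB => j; exact: ptws_cvg.
Qed.

Section OperatorNorm.
Context {R : realType} {H : completeNormedModType R[i]}.
Context {ip : {dot H for @Num.conj R[i]}}.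
Local Notation C := R[i].

Lemma opnorm_bound (T : H -> H) v : bounded_op T ->
  `|T v| <= (opnorm T)%:C * `|v|.
Proof.
move=> /bounded_opP[lT [M M0 TM]].
have [->|v0] := eqVneq v 0; first by rewrite linear_op0 // !normr0 mulr0.
have vp : 0 < `|v| by rewrite normr_gt0.
rewrite -ler_pdivrMr // mulrC.
have -> : `|v|^-1 * `|T v| = `|T (`|v|^-1 *: v)|.
  by rewrite linear_opZ // normrZ normfV normr_id.
set u := _ *: v; have u1 : `|u| <= 1.
  by rewrite /u normrZ normfV normr_id mulVf // gt_eqF.
rewrite -[leLHS]RRe_real ?normr_real // lecR; apply: ub_le_sup; last by exists u.
exists (complex.Re M) => _ [w /= w1 <-]; apply: Re_le.
by apply: le_trans (TM w) _; rewrite ler_piMr.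
Qed.

Lemma norm_bounded_uniform g (K : set ('I_g -> H -> H)) :
  K `<=` sa_tuple ip (g := g) -> norm_bounded K ->
  exists2 M : C, 0 <= M & forall X j v, K X -> `|X j v| <= M * `|v|.
Proof.
move=> saK [M KM]; exists (`|M|%:C); first by rewrite ler0c.
move=> X j v KX; have [bX _] := saK _ KX j.
apply: le_trans (opnorm_bound v bX) _; rewrite ler_wpM2r // lecR.
apply: le_trans (ler_norm M); apply: le_trans (KM _ KX).
exact: (le_bigmax _ (fun j => opnorm (X j))).
Qed.

End OperatorNorm.

(** * Staircase form and strong ultralimits *)

Section Staircase.
Context {R : realType} {H : completeNormedModType R[i]}.
Context {ip : {dot H for @Num.conj R[i]}}.
Context (ip_norm : forall v : H, ip v v = `|v| ^+ 2).
Context (H_infinite : infinite_dimensional H).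
Context {e : nat -> H} (be : orthonormal_basis ip e).
Local Notation C := R[i].
Local Notation Co := (R[i]^o).

(** The vector with the same coordinates with respect to [e] is an explicit preimage of [y], and the
    adjoint of an isometry recovers preimages. *)
Lemma isometry_preimage_oproj V (b : nat -> H) m y : isometry_op ip V ->
  (forall i, V (e i) = b i) -> orthonormal_family ip b ->
  y = oproj_nat ip b m y ->
  V (adjoint ip V y) = y /\
  adjoint ip V y = oproj_nat ip e m (adjoint ip V y).
Proof.
move=> iV Ve ob yE; pose z := \sum_(i < m) ip y (b i) *: e i.
have Vz : V z = y.
  rewrite [RHS]yE /oproj_nat /oproj (linear_op_sum _ _ _ iV.1).
  by apply: eq_bigr => i _; rewrite (linear_opZ _ _ iV.1) Ve.
have -> : adjoint ip V y = z.
  by rewrite -Vz (isometry_adjointK ip_norm be).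
by split=> //; apply: (oprojE (orthonormal_ord be.1 (n := m)) (erefl z)).
Qed.

(* Gram-Schmidt along the schedule "k_q at stage q(g+1), X_j b_q at stage
   q(g+1)+j+1" produces an orthonormal sequence whose closed span reduces X and
   contains every k_q; the resulting sparsity pattern does not depend on X. *)
Lemma staircase_compression g (X : 'I_g -> H -> H) (k : nat -> H) :
  sa_tuple ip X ->
  exists V kh, [/\ isometry_op ip V,
    forall j v, V (compress ip V X j v) = X j (V v),
    forall i j, compress ip V X j (e i) =
      oproj_nat ip e (i * g.+1 + j).+2 (compress ip V X j (e i)),
    forall a, V (kh a) = k a &
    forall a, kh a = oproj_nat ip e (a * g.+1).+1 (kh a)].
Proof.
move=> saX.
(* A remainder [t.+1] modulo [g.+1] has [t < g], so [insub] succeeds and the value 0 is only a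
   filler. *)
pose task (s : seq H) : H := let n := size s in
  if (n %% g.+1)%N is t.+1 then
    if insub t : option 'I_g is Some j then X j s`_(n %/ g.+1) else 0
  else k (n %/ g.+1)%N.
have [b ob bE] := adaptive_gram_schmidt ip_norm H_infinite task.
have kb a : k a = oproj_nat ip b (a * g.+1).+1 (k a).
  have := bE (a * g.+1)%N.
  by rewrite /task size_mkseq modnMl mulnK.
(* [X j (b i)] is treated at stage [i * g.+1 + j + 1], when [b i] already exists; one more vector is
   then available, whence the [.+2]. *)
have Xb i j : X j (b i) = oproj_nat ip b (i * g.+1 + j).+2 (X j (b i)).
  have := bE (i * g.+1 + j).+1; rewrite /task size_mkseq -addnS.
  rewrite modnMDl divnMDl // modn_small ?ltnS // divn_small ?ltnS // addn0.
  rewrite (_ : insub (j : nat) = Some j); last exact: (valK j).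
  by rewrite nth_mkseq // addnS ltnS (leq_trans _ (leq_addr _ _)) // leq_pmulr.
have [V iV Ve] := isometry_of_families ip_norm be ob.
have bV := isometry_bounded ip_norm iV.
have bX j : bounded_op (X j) by case: (saX j).
exists V, (fun a => adjoint ip V (k a)); split=> //.
- move=> j.
  have bc : bounded_op (compress ip V X j).
    by have [] := sa_tuple_compress ip_norm be saX iV j.
  (* On the basis the intertwining says that [V] times its adjoint fixes [X j (b i)], which holds
     because that vector lies in the span of the [b]'s. *)
  have E : (fun v => V (compress ip V X j v)) = (fun v => X j (V v)).
    apply: (basis_eq_op be (bounded_op_comp bV bc) (bounded_op_comp (bX j) bV)).
    move=> i; rewrite /compress Ve.
    by have [-> _] := isometry_preimage_oproj iV Ve ob (Xb i j).
  by move=> v; exact: (congr1 (fun f => f v) E).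
- move=> i j; rewrite /compress Ve.
  by have [_ <-] := isometry_preimage_oproj iV Ve ob (Xb i j).
- by move=> a; have [-> _] := isometry_preimage_oproj iV Ve ob (kb a).
- by move=> a; have [_ <-] := isometry_preimage_oproj iV Ve ob (kb a).
Qed.

(** The sequence is bounded in one finite-dimensional space, so each of its [m] coordinates has an
    ultralimit. *)
Lemma ultra_cvg_oproj {T : Type} {U : set_system T} {UU : UltraFilter U}
    (x : T -> H) m (M : C) :
  (forall n, x n = oproj_nat ip e m (x n)) -> (\forall n \near U, `|x n| <= M) ->
  cvg (x @ U).
Proof.
move=> xE xM.
have /choice[c cP] (i : 'I_m) : exists c : Co, (fun n => ip (x n) (e i) : Co) @ U --> c.
  apply: (@ultra_cvg_complex _ _ _ _ _ M); apply: filterS xM => n xnM.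
  apply: le_trans (cauchy_schwarz ip_norm _ _) _.
  by rewrite (norm1 ip_norm (u := e i)) ?mulr1 // be.1 eqxx.
apply: (cvgP (\sum_(i < m) c i *: e i)).
rewrite (_ : x = fun n => oproj_nat ip e m (x n)); last exact/funext.
by apply: cvg_lincomb => i; exact: cP.
Qed.

Section GammaLimit.
Context (g r : nat) (Gam : 'I_r -> free_poly R[i] g).
Context (K : set ('I_g -> H -> H)).
Context (K_sa : K `<=` sa_tuple ip (g := g)).
Context (K_closed : sot_closed ip K).
Context (K_convex : gamma_convex ip Gam K).
Context (K_bounded : norm_bounded K).
Context {U : set_system nat} {UU : UltraFilter U}.

(** The tuples [X n] may converge only weakly, which polynomials do not respect. Their staircase
    compressions have the same moments, remain in [K], and converge strongly, since the span
    containing [Xh n j (e i)] does not depend on [n]. *)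
Lemma gamma_convex_ultralimit (X : nat -> 'I_g -> H -> H) (k : nat -> nat -> H) :
  (forall n, K (X n)) ->
  (forall a, exists M : C, \forall n \near U, `|k n a| <= M) ->
  exists Y kap, K Y /\ forall (p : free_poly R[i] g) a b,
    (fun n => ip (poly_eval p (X n) (k n a)) (k n b) : Co) @ U -->
      (ip (poly_eval p Y (kap a)) (kap b) : Co).
Proof.
move=> KX kM.
have [M M0 KM] := norm_bounded_uniform K_sa K_bounded.
have /choice[V Vkh] n := staircase_compression (k n) (K_sa (KX n)).
have /choice[kh VP] := Vkh.
pose Xh n := compress ip (V n) (X n).
have iV n : isometry_op ip (V n) by case: (VP n).
have VXh n j v : V n (Xh n j v) = X n j (V n v).
  by have [_ VX _ _ _] := VP n; exact: VX.
have saXh n : sa_tuple ip (Xh n).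
  by apply: (sa_tuple_compress ip_norm be) => //; exact: K_sa.
(* Intertwining moves [V n] through every polynomial, so its adjoint cancels it and the compression
   is by a Gamma-pair. *)
have KXh n : K (Xh n).
  apply: (K_convex.2 _ _ (KX n)); split=> //; first exact: K_sa.
  apply/funext => j; apply/funext => v; rewrite {1}/compress /tuple_eval.
  rewrite -(poly_eval_intertwine _ _ (iV n).1 (VXh n)).
  by rewrite (isometry_adjointK ip_norm be).
have Xhe i j : cvg (Xh n j (e i) @[n --> U]).
  apply: (@ultra_cvg_oproj _ _ _ _ (i * g.+1 + j).+2 (M * `|e i|)).
    by move=> n; have [_ _ XhE _ _] := VP n; exact: XhE.
  by apply: nearW => n; exact: KM.
have khc a : cvg (kh n a @[n --> U]).
  have [N kN] := kM a.
  apply: (@ultra_cvg_oproj _ _ _ _ (a * g.+1).+1 N).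
    by move=> n; have [_ _ _ _ khE] := VP n; exact: khE.
  apply: filterS kN => n; have [_ _ _ <- _] := VP n.
  by rewrite (isometry_norm ip_norm).
have lX n j : linear (Xh n j) by have [[]] := saXh n j.
have XM n j v : `|Xh n j v| <= M * `|v| by exact: KM.
pose Y j := limit_op (F := U) (fun n => Xh n j).
have XY j v : Xh n j v @[n --> U] --> Y j v.
  exact: (limit_opP be M0 (lX ^~ j) (fun n => XM n j) (fun i => @Xhe i j)).
have saY : sa_tuple ip Y.
  move=> j; split.
    exact: (limit_op_bounded be M0 (lX ^~ j) (fun n => XM n j) (fun i => @Xhe i j)).
  move=> u v; apply: (cvg_uniq (cvg_ip ip_norm (XY j u) (cvg_cst v))).
  have -> : (fun n => ip (Xh n j u) (cst v n) : Co) = (fun n => ip u (Xh n j v)).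
    by apply/funext => n; have [_ ->] := saXh n j.
  exact: (cvg_ip ip_norm (cvg_cst u) (XY j v)).
exists Y, (fun a => lim (kh n a @[n --> U])); split.
  exact: (sot_closed_limit K_closed KXh XY saY).
move=> p a b.
have -> : (fun n => ip (poly_eval p (X n) (k n a)) (k n b) : Co) =
    (fun n => ip (poly_eval p (Xh n) (kh n a)) (kh n b)).
  apply/funext => n; have [_ _ _ Vk _] := VP n; rewrite -!Vk.
  by rewrite -(poly_eval_intertwine _ _ (iV n).1 (VXh n)) (iV n).2.
exact: (cvg_ip ip_norm (cvg_poly_eval lX XM XY (p := p) (@khc a)) (@khc b)).
Qed.

End GammaLimit.
End Staircase.

(** * Separation from a convex cone *)

Lemma exists_ultrafilter_nat :
  exists U : set_system nat, UltraFilter U /\ \oo `<=` U.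
Proof. exact: ultraFilterLemma. Qed.

(** First-order optimality: the linear term dominates for small [t]. The range stops at 1 because
    one application scales a point of the cone by [1 - t]. *)
Lemma ge0_of_quadratic (R : realFieldType) (a b : R) :
  (forall t, 0 <= t <= 1 -> 0 <= 2 * t * a + t ^+ 2 * b) -> 0 <= a.
Proof.
move=> ab; rewrite leNgt; apply/negP => a0.
have b1 : 0 < `|b| + 1 by rewrite ltr_wpDl.
(* Small enough that [t * b <= - a], making [2 * a + t * b] at most [a], hence negative. *)
pose t := Num.min 1 (- a / (`|b| + 1)).
have t0 : 0 < t by rewrite lt_min ltr01 divr_gt0 // oppr_gt0.
have t1 : t <= 1 by rewrite ge_min lexx.
have tb : t * `|b| <= - a.
  apply: (@le_trans _ _ (t * (`|b| + 1))); first by rewrite ler_pM2l // lerDl.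
  by rewrite -ler_pdivlMr // ge_min lexx orbT.
have tb' : t * b <= - a.
  by apply: le_trans tb; rewrite ler_pM2l // ler_norm.
have := ab t; rewrite (ltW t0) t1 => /(_ isT).
have -> : 2 * t * a + t ^+ 2 * b = t * (2 * a + t * b) by ring.
by rewrite pmulr_rge0 //; lra.
Qed.

Section ConeSeparation.
Context {R : realType} {J : finType}.
Implicit Types p q : J -> R.

Let dot p q := \sum_i p i * q i.

(* The minimal distance from q0 to Q need not be attained, so the normal vector
   is taken as an ultralimit of p_n - q0 along a minimising sequence p_n. *)
Lemma cone_separation (Q : set (J -> R)) q0 eps : 0 < eps -> Q !=set0 ->
  (forall p q, Q p -> Q q -> Q (fun i => p i + q i)) ->
  (forall t p, 0 <= t -> Q p -> Q (fun i => t * p i)) ->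
  (forall q, Q q -> eps <= \sum_i (q i - q0 i) ^+ 2) ->
  exists y, (forall q, Q q -> 0 <= \sum_i y i * q i) /\ \sum_i y i * q0 i < 0.
Proof.
move=> eps0 [q1 Qq1] QD QZ Qeps.
pose D q := \sum_i (q i - q0 i) ^+ 2.
pose d := inf (D @` Q).
have hinf : has_inf (D @` Q).
  split; first by exists (D q1), q1.
  by exists eps => _ [q Qq <-]; exact: Qeps.
have dD q : Q q -> d <= D q by move=> Qq; apply: ge_inf hinf.2 _ _; exists q.
have dt n : 0 < n.+1%:R^-1 :> R by [].
have /choice[p pP] n : exists p, Q p /\ D p < d + n.+1%:R^-1.
  by have [_ [p Qp <-] Dp] := inf_adherent (dt n) hinf; exists p.
have [U [UU sU]] := exists_ultrafilter_nat.
have Dp1 n : D (p n) <= d + 1.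
  have [_ /ltW Dn] := pP n; apply: le_trans Dn _; rewrite lerD2l.
  by rewrite invf_le1 // ler1n.
have /choice[y yP] i : exists y : R, (fun n => p n i - q0 i) @ U --> y.
  apply: (@ultra_cvg_real _ _ _ _ _ (d + 1 + 1)); apply: nearW => n.
  have : (p n i - q0 i) ^+ 2 <= d + 1.
    apply: le_trans (Dp1 n); rewrite /D (bigD1 i) //= lerDl.
    by apply: sumr_ge0 => j _; exact: sqr_ge0.
  (* From [z ^+ 2 <= d + 1] and [(|z| - 1) ^+ 2 >= 0] a linear bound on [|z|] follows. *)
  set z := p n i - q0 i; rewrite -[z ^+ 2]real_normK ?num_real//.
  have : 0 <= (`|z| - 1) ^+ 2 by exact: sqr_ge0.
  have := normr_ge0 z; nra.
have invU : (fun n => n.+1%:R^-1 : R) @ U --> (0 : R).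
  by apply: cvg_trans (@cvg_harmonic R) => A /sU.
have lim_ge0 (f : nat -> R) (l : R) : f @ U --> l ->
    (forall n, - n.+1%:R^-1 <= f n) -> 0 <= l.
  move=> fl fge; rewrite leNgt; apply/negP => l0.
  have l2 : l < l / 2 by rewrite ltr_pdivlMr // mulr_natr mulr2n gtrDl.
  have l20 : 0 < - (l / 2) by rewrite oppr_gt0 pmulr_llt0.
  pose proof (cvgr_lt _ fl _ l2) as f1; pose proof (cvgr_lt _ invU _ l20) as f2.
  have [n [/= n1 n2]] := filter_ex (filterI f1 f2).
  move: (fge n) n1 n2; move: (f n) (n.+1%:R^-1) => x x'; lra.
have dot_cvg (f h : nat -> J -> R) (a b : J -> R) :
    (forall i, (fun n => f n i) @ U --> a i) ->
    (forall i, (fun n => h n i) @ U --> b i) ->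
    (fun n => dot (f n) (h n)) @ U --> dot a b.
  move=> fa hb; apply: cvg_big => [|i _]; first exact: add_continuous.
  by apply: cvgM; [exact: fa|exact: hb].
have DD n s q : D (fun i => p n i + s * q i) =
    D (p n) + (2 * s * dot (fun i => p n i - q0 i) q + s ^+ 2 * dot q q).
  rewrite /D /dot !mulr_sumr -!big_split; apply: eq_bigr => i _ /=; ring.
(* [p n] minimises [D] up to [1/(n+1)], so no move inside [Q] lowers [D] by more than that. *)
have Dge n s q : Q (fun i => p n i + s * q i) ->
    - n.+1%:R^-1 <= 2 * s * dot (fun i => p n i - q0 i) q + s ^+ 2 * dot q q.
  move=> Qs; have := dD _ Qs; rewrite DD; have [_] := pP n.
  move: (n.+1%:R^-1) (D (p n)) => x x'; lra.
have lc (f g : nat -> R) (a b s t : R) : f @ U --> a -> g @ U --> b ->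
    (fun n => s * f n + t * g n) @ U --> s * a + t * b.
  move=> fa gb; apply: cvgD; apply: cvgM => //; exact: cvg_cst.
exists y; split=> [q Qq|].
  apply: (@ge0_of_quadratic _ _ (dot q q)) => t /andP[t0 _].
  apply: (lim_ge0 (fun n =>
      2 * t * dot (fun i => p n i - q0 i) q + t ^+ 2 * dot q q)) => [|n].
    apply: (lc _ _ (dot y q) (dot q q)); last exact: cvg_cst.
    by apply: dot_cvg => // i; exact: cvg_cst.
  by apply: Dge; apply: QD; [case: (pP n)|exact: QZ].
pose z i := y i + q0 i.
have pz i : (fun n => p n i) @ U --> z i.
  rewrite (_ : (fun n => p n i) = fun n => (p n i - q0 i) + q0 i).
    by apply: cvgD => //; exact: cvg_cst.
  by apply/funext => n; rewrite subrK.
(* Moving [p n] towards the apex, to [(1 - t) * p n], stays in the cone and gives [dot y z <= 0] in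
   the limit; with [eps <= dot y y] this makes [y] negative at [q0 = z - y]. *)
have yz : 0 <= - dot y z.
  apply: (@ge0_of_quadratic _ _ (dot z z)) => t /andP[t0 t1].
  rewrite mulrN -mulNr -mulrN -sqrrN.
  apply: (lim_ge0 (fun n => 2 * - t * dot (fun i => p n i - q0 i) (p n) +
      (- t) ^+ 2 * dot (p n) (p n))) => [|n].
    apply: (lc _ _ (dot y z) (dot z z)); exact: dot_cvg.
  apply: Dge; have -> : (fun i => p n i + - t * p n i) = (fun i => (1 - t) * p n i).
    by apply/funext => i; ring.
  by apply: QZ; [rewrite subr_ge0|case: (pP n)].
have yy : eps <= dot y y.
  rewrite -subr_ge0.
  apply: (lim_ge0 (fun n => dot (fun i => p n i - q0 i) (fun i => p n i - q0 i) - eps)).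
    by apply: cvgB; [exact: dot_cvg|exact: cvg_cst].
  move=> n; apply: (@le_trans _ _ 0); first by rewrite oppr_le0 ltW.
  by rewrite subr_ge0; apply: Qeps; case: (pP n).
have -> : \sum_i y i * q0 i = dot y z - dot y y.
  by rewrite /dot -sumrB; apply: eq_bigr => i _; rewrite /z; ring.
lra.
Qed.

End ConeSeparation.

(** * Direct sums and operator convexity of pencil domains *)

Section DirectSum.
Context {R : realType} {H : completeNormedModType R[i]}.
Context {ip : {dot H for @Num.conj R[i]}}.
Context (ip_norm : forall v : H, ip v v = `|v| ^+ 2).

(** The isometries [V0] and [V1] send the basis to its even and odd members; their ranges are
    orthogonal and together fill [H]. *)
Lemma exists_sum_unitary2 (e : nat -> H) : orthonormal_basis ip e ->
  exists (W : ('I_2 -> H) -> H) W', sum_unitary ip W W'.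
Proof.
move=> be; have oe := be.1.
have [V0 iV0 V0e] := isometry_of_families ip_norm be
  (orthonormal_sub (f := double) double_inj oe).
have inj1 : injective (fun n => n.*2.+1) by move=> m n [/double_inj].
have [V1 iV1 V1e] := isometry_of_families ip_norm be (orthonormal_sub inj1 oe).
have b0 := isometry_bounded ip_norm iV0; have b1 := isometry_bounded ip_norm iV1.
have a0 := adjoint_bounded ip_norm be b0.
have a1 := adjoint_bounded ip_norm be b1.
have adjK0 := isometry_adjointK ip_norm be _ iV0.
have adjK1 := isometry_adjointK ip_norm be _ iV1.
have adj01 i : adjoint ip V0 (e i.*2.+1) = 0.
  apply: (basis_extl be) => j.
  rewrite ip0l ipC -(adjointP ip_norm be) // V0e oe.
  by case: eqP => [/(congr1 odd)|_]; rewrite /= ?odd_double // rmorph0.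
have adj10 i : adjoint ip V1 (e i.*2) = 0.
  apply: (basis_extl be) => j.
  rewrite ip0l ipC -(adjointP ip_norm be) // V1e oe.
  by case: eqP => [/(congr1 odd)|_]; rewrite /= ?odd_double // rmorph0.
have V01 v : adjoint ip V0 (V1 v) = 0.
  have E : (fun v => adjoint ip V0 (V1 v)) = (fun v => 0 *: v).
    apply: (basis_eq_op be (bounded_op_comp a0 b1)) => [|i].
      exact: (bounded_op_scale 0 (@bounded_op_id _ H)).
    by rewrite V1e adj01 scale0r.
  by rewrite -[LHS]/((fun v => adjoint ip V0 (V1 v)) v) E scale0r.
have o01 u v : ip (V0 u) (V1 v) = 0 by rewrite (adjointP ip_norm be) // V01 ip0r.
have V10 v : adjoint ip V1 (V0 v) = 0.
  apply: (@ip_extr _ _ ip) => u.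
  by rewrite -(adjointP ip_norm be) // ipC o01 rmorph0 ip0r.
have V_id v : V0 (adjoint ip V0 v) + V1 (adjoint ip V1 v) = v.
  have E : (fun v => V0 (adjoint ip V0 v) + V1 (adjoint ip V1 v)) = (fun v => v).
    apply: (basis_eq_op be) => [||i].
    - exact: (bounded_op_add (bounded_op_comp b0 a0) (bounded_op_comp b1 a1)).
    - exact: bounded_op_id.
    rewrite -(odd_double_half i); case: (odd i); rewrite ?add1n ?add0n.
      by rewrite adj01 (linear_op0 iV0.1) add0r -V1e adjK1.
    by rewrite adj10 (linear_op0 iV1.1) addr0 -V0e adjK0.
  by rewrite -[LHS]/((fun v => V0 (adjoint ip V0 v) + V1 (adjoint ip V1 v)) v) E.
exists (fun h => V0 (h ord0) + V1 (h ord_max)),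
  (fun v i => if i == ord0 then adjoint ip V0 v else adjoint ip V1 v); split.
- move=> a u v /=; rewrite iV0.1 iV1.1 scalerDr -!addrA; congr (_ + _).
  by rewrite addrCA.
- move=> h k; rewrite big_ord_recl big_ord_recl big_ord0 addr0.
  rewrite (_ : lift ord0 ord0 = ord_max); last exact: val_inj.
  rewrite ipDl !ipDr (ipC (V1 _)) !o01 rmorph0 addr0 add0r.
  by rewrite iV0.2 iV1.2.
- move=> h; apply/funext => i; have [->|i0] := eqVneq i ord0.
    by rewrite /= (linear_opD _ _ a0.1) adjK0 V01 addr0.
  rewrite /= (linear_opD _ _ a1.1) adjK1 V10 add0r; congr (h _).
  by apply: val_inj; case: i i0 => [[|[|]]].
- by move=> v /=.
Qed.

Section Given.
Context {n : nat} {W : ('I_n -> H) -> H} {W' : H -> 'I_n -> H}.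
Context (sumW : sum_unitary ip W W').

Lemma sum_unitary_ip u v : ip u v = \sum_i ip (W' u i) (W' v i).
Proof. by have [_ ipW _ WK] := sumW; rewrite -ipW !WK. Qed.

Lemma sum_unitary_inv_linear i : linear (fun v => W' v i).
Proof.
have [lW _ KW WK] := sumW; move=> a u v.
rewrite -{1}(WK u) -{1}(WK v) -[a *: W _ + _]/(a *: W _ + _).
by rewrite -lW KW.
Qed.

Lemma sum_unitary_inv_bounded i : bounded_op (fun v => W' v i).
Proof.
split; first exact: sum_unitary_inv_linear.
exists 1 => v; rewrite mul1r -(ler_sqr_norm ip_norm) (sum_unitary_ip v v).
by rewrite (bigD1 i) //= lerDl sumr_ge0 // => j _; exact: ip_ge0.
Qed.

Let inj i (h : H) : 'I_n -> H := fun j => if j == i then h else 0.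

Lemma sum_unitary_inj_bounded i : bounded_op (fun h => W (inj i h)).
Proof.
have [lW ipW KW WK] := sumW; split.
  move=> a u v; rewrite -lW; congr W; apply/funext => j.
  rewrite -[RHS]/(a *: inj i u j + inj i v j) /inj.
  by case: eqP => // _; rewrite scaler0 addr0.
exists 1 => v; rewrite mul1r -(ler_sqr_norm ip_norm) ipW (bigD1 i) //= big1.
  by rewrite addr0 /inj eqxx.
by move=> j /negbTE ji; rewrite /inj ji ip0l.
Qed.

(** This exhibits a direct sum as a finite sum of bounded operators on [H], whence its
    boundedness. *)
Lemma sum_unitary_decomp h : W h = \sum_i W (inj i (h i)).
Proof.
have [lW ipW KW WK] := sumW; apply: (@ip_extl _ _ ip) => v.
rewrite ip_suml -(WK v) ipW; apply: eq_bigr => i _.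
rewrite ipW (bigD1 i) //= big1 ?addr0 /inj ?eqxx //.
by move=> j /negbTE ->; rewrite ip0l.
Qed.

Section Tuples.
Context {g : nat} (X : 'I_n -> 'I_g -> H -> H).

Lemma direct_sum_inv j v i : W' (direct_sum W W' X j v) i = X i j (W' v i).
Proof. by have [_ _ KW _] := sumW; rewrite /direct_sum KW. Qed.

Lemma direct_sum_sa : (forall i, sa_tuple ip (X i)) ->
  sa_tuple ip (direct_sum W W' X).
Proof.
move=> saX j; split.
  rewrite (_ : direct_sum _ _ _ _ = fun v => \sum_i W (inj i (X i j (W' v i)))).
    apply: bounded_op_sum => i.
    apply: (bounded_op_comp (sum_unitary_inj_bounded i)).
    exact: (bounded_op_comp (saX i j).1 (sum_unitary_inv_bounded i)).
  by apply/funext => v; rewrite /direct_sum sum_unitary_decomp.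
move=> u v; rewrite !sum_unitary_ip; apply: eq_bigr => i _.
by rewrite !direct_sum_inv (saX i j).2.
Qed.

Lemma poly_eval_direct_sum p v i :
  W' (poly_eval p (direct_sum W W' X) v) i = poly_eval p (X i) (W' v i).
Proof.
exact: (poly_eval_intertwine _ _ (sum_unitary_inv_linear i)
  (fun j u => direct_sum_inv j u i)).
Qed.

End Tuples.
End Given.
End DirectSum.

Section Forms.
Context {R : realType} {H : completeNormedModType R[i]}.
Context {ip : {dot H for @Num.conj R[i]}}.
Context (ip_norm : forall v : H, ip v v = `|v| ^+ 2).
Context {e : nat -> H} (be : orthonormal_basis ip e).
Local Notation C := R[i].
Context {N : nat}.
Implicit Types (c : 'M[C]_N) (T : H -> H) (h : 'I_N -> H).

(** The quadratic form of the tensor product of [c] and [T], evaluated at [h]. *)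
Definition op_form c T h : C := \sum_a \sum_b c a b * ip (T (h b)) (h a).

(** The quadratic form of a linear pencil with arbitrary constant coefficient [c]; it is monic for
    [c = 1%:M]. *)
Definition tuple_form r c (B : 'I_r -> 'M[C]_N) (Z : 'I_r -> H -> H) h : C :=
  op_form c id h + \sum_j op_form (B j) (Z j) h.

Lemma op_form_sum n c T h (T' : 'I_n -> H -> H) (h' : 'I_n -> 'I_N -> H) :
  (forall a b, ip (T (h b)) (h a) = \sum_i ip (T' i (h' i b)) (h' i a)) ->
  op_form c T h = \sum_i op_form c (T' i) (h' i).
Proof.
move=> TT; rewrite /op_form [RHS]exchange_big; apply: eq_bigr => a _ /=.
rewrite [RHS]exchange_big; apply: eq_bigr => b _ /=.
by rewrite TT mulr_sumr.
Qed.

Lemma eq_op_form c T h T' h' :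
  (forall a b, ip (T (h b)) (h a) = ip (T' (h' b)) (h' a)) ->
  op_form c T h = op_form c T' h'.
Proof.
by move=> TT; apply: eq_bigr => a _; apply: eq_bigr => b _; rewrite TT.
Qed.

(** A compression moves [V] onto the vectors [h], and a direct sum turns the form into a sum of
    forms of the summands; both preserve nonnegativity. *)
Lemma tuple_form_operator_convex r c (B : 'I_r -> 'M[C]_N) :
  operator_convex ip
    [set Z | sa_tuple ip Z /\ forall h, 0 <= tuple_form c B Z h].
Proof.
have convV Z V : sa_tuple ip Z /\ (forall h, 0 <= tuple_form c B Z h) ->
    isometry_op ip V -> sa_tuple ip (compress ip V Z) /\
    (forall h, 0 <= tuple_form c B (compress ip V Z) h).
  move=> [saZ Z0] iV; split; first exact: (sa_tuple_compress ip_norm be).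
  move=> h; suff -> : tuple_form c B (compress ip V Z) h =
      tuple_form c B Z (fun a => V (h a)) by [].
  congr (_ + _).
    by apply: eq_op_form => a b; rewrite iV.2.
  apply: eq_bigr => j _; apply: eq_op_form => a b.
  rewrite ipC -(adjointP ip_norm be) -?ipC //.
  exact: isometry_bounded.
split; last by [].
split; first by move=> Z [].
  by move=> Z V KZ [iV _]; exact: convV.
move=> n W W' Z n0 sumW KZ; split.
  by apply: (direct_sum_sa ip_norm sumW) => i; case: (KZ i).
move=> h; suff -> : tuple_form c B (direct_sum W W' Z) h =
    \sum_i tuple_form c B (Z i) (fun a => W' (h a) i).
  by apply: sumr_ge0 => i _; case: (KZ i).
rewrite big_split /=; congr (_ + _).
  by apply: op_form_sum => a b; exact: (sum_unitary_ip sumW).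
rewrite [RHS]exchange_big; apply: eq_bigr => j _; apply: op_form_sum => a b.
rewrite (sum_unitary_ip sumW); apply: eq_bigr => i _.
by rewrite (direct_sum_inv sumW).
Qed.

Lemma opco_tuple_form r c (B : 'I_r -> 'M[C]_N) (S : set ('I_r -> H -> H)) Z :
  (forall X, S X -> sa_tuple ip X /\ forall h, 0 <= tuple_form c B X h) ->
  opco ip S Z -> forall h, 0 <= tuple_form c B Z h.
Proof.
move=> SB /(_ _ (conj (tuple_form_operator_convex c B) SB)) [_].
exact.
Qed.

Lemma psd_linear_pencil r (A : 'I_r -> 'M[C]_N) Z :
  psd ip (linear_pencil A Z) <-> forall h, 0 <= tuple_form 1%:M A Z h.
Proof.
suff E h : \sum_i ip (linear_pencil A Z h i) (h i) = tuple_form 1%:M A Z h.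
  by split=> P h; [rewrite -E|rewrite E]; exact: P.
rewrite /tuple_form /op_form [X in _ = _ + X]exchange_big /= -big_split.
apply: eq_bigr => a _ /=; rewrite ipDl; congr (_ + _).
  rewrite (bigD1 a) //= big1 ?addr0 => [|b /negbTE ba].
    by rewrite mxE eqxx mul1r.
  by rewrite mxE eq_sym ba mul0r.
rewrite ip_suml; apply: eq_bigr => j _; rewrite ip_suml; apply: eq_bigr => b _.
by rewrite ipZl.
Qed.

Local Notation "M ^t*" := (map_mx Num.conj (trmx M)) (at level 30).

Lemma op_form_congr c (P : 'M[C]_N) T h : linear T ->
  op_form c T (fun a => \sum_i P a i *: h i) = op_form (P ^t* *m c *m P) T h.
Proof.
move=> lT; rewrite /op_form.
transitivity (\sum_a \sum_b \sum_l \sum_i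
    (P a l)^* * c a b * P b i * ip (T (h i)) (h l)).
  apply: eq_bigr => a _; apply: eq_bigr => b _.
  rewrite (linear_op_sum _ _ _ lT) ip_sumr mulr_sumr; apply: eq_bigr => l _.
  rewrite ip_suml mulr_sumr; apply: eq_bigr => i _.
  by rewrite (linear_opZ _ _ lT) ipZl ipZr; ring.
transitivity (\sum_l \sum_i \sum_a \sum_b
    (P a l)^* * c a b * P b i * ip (T (h i)) (h l)).
  under eq_bigr do rewrite exchange_big /=.
  rewrite exchange_big /=; apply: eq_bigr => l _.
  under eq_bigr do rewrite exchange_big /=.
  by rewrite exchange_big.
apply: eq_bigr => l _; apply: eq_bigr => i _.
rewrite !mxE mulr_suml exchange_big /=; apply: eq_bigr => b _.
rewrite !mxE !mulr_suml; apply: eq_bigr => a _.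
by rewrite !mxE.
Qed.

End Forms.
Arguments op_form {R H} ip {N} c T h.
Arguments tuple_form {R H} ip {N r} c B Z h.

Local Notation "M ^t*" := (map_mx Num.conj (trmx M)) (at level 30).

(** * Normalising a nonnegative form to a monic pencil *)

Section MonicPencil.
Context {R : realType} {H : completeNormedModType R[i]}.
Context {ip : {dot H for @Num.conj R[i]}}.
Local Notation C := R[i].
Context {N : nat}.
Implicit Types (c B P : 'M[C]_N) (T : H -> H) (h : 'I_N -> H).

Lemma hermsymmxP c : reflect (c = c ^t*) (c \is hermsymmx).
Proof. by apply: (iffP (is_hermitianmxP _ _ _)); rewrite expr0 scale1r. Qed.

Lemma hermsymmx_congr B P : B \is hermsymmx -> P ^t* *m B *m P \is hermsymmx.
Proof.
move=> /hermsymmxP hB; apply/hermsymmxP.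
rewrite !trmx_mul !map_mxM /= -mulmxA {1}hB; congr (_ *m (_ *m _)).
by apply/matrixP => i j; rewrite !mxE conjCK.
Qed.

Lemma op_form_add c c' T h :
  op_form ip (c + c') T h = op_form ip c T h + op_form ip c' T h.
Proof.
rewrite /op_form -big_split; apply: eq_bigr => a _ /=.
by rewrite -big_split; apply: eq_bigr => b _; rewrite mxE mulrDl.
Qed.

Lemma op_form_scalar x T h :
  op_form ip x%:M T h = x * \sum_a ip (T (h a)) (h a).
Proof.
rewrite /op_form mulr_sumr; apply: eq_bigr => a _.
rewrite (bigD1 a) //= big1 ?addr0 => [|b /negbTE ba]; rewrite mxE.
  by rewrite eqxx.
by rewrite eq_sym ba mul0r.
Qed.

(** Testing on elementary tensors with a unit vector [u] converts positivity of the form on tuples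
    of vectors into positivity of the matrix [c]. *)
Lemma op_form_rank1 c P i u : ip u u = 1 ->
  op_form ip c id (fun a => (P i a)^* *: u) = (P *m c *m P ^t*) i i.
Proof.
move=> u1; rewrite /op_form mxE exchange_big /=; apply: eq_bigr => b _.
rewrite !mxE mulr_suml; apply: eq_bigr => a _.
by rewrite ipZl ipZr u1 conjCK mulr1; ring.
Qed.

(** Positivity is assumed for diagonal entries in every unitary frame; in the spectral frame these
    are the eigenvalues [D], and [S] is the square root of [D] times [P]. *)
Lemma hermitian_factor c : c \is hermsymmx ->
  (forall P i, P *m P ^t* = 1%:M -> 0 < (P *m c *m P ^t*) i i) ->
  exists2 S, S \in unitmx & c = S ^t* *m S.
Proof.
move=> hc cpos; have /orthomx_spectralP := hermitian_normalmx hc.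
set P := spectralmx c; set D := spectral_diag c => cE.
have uP : P \is unitarymx := spectral_unitarymx c.
have PP : P *m P ^t* = 1%:M by exact/unitarymxP.
have iP : invmx P = P ^t* by exact: invmx_unitary.
have Dpos i : 0 < D 0 i.
  have := cpos P i PP; rewrite cE iP !mulmxA PP mul1mx -mulmxA PP mulmx1.
  by rewrite mxE eqxx mulr1n.
pose S := diag_mx (map_mx sqrtC D) *m P.
exists S.
  rewrite unitmx_mul spectral_unit andbT unitmxE det_diag unitfE.
  by apply/prodf_neq0 => i _; rewrite mxE sqrtC_eq0 gt_eqF.
rewrite {1}cE iP /S trmx_mul map_mxM /= tr_diag_mx map_diag_mx -!mulmxA.
congr (_ *m _); rewrite !mulmxA; congr (_ *m _).
rewrite mulmx_diag; congr diag_mx; apply/rowP => i; rewrite !mxE /=.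
have s0 : 0 <= sqrtC (D 0 i) by rewrite sqrtC_ge0 ltW.
have -> : Num.conj (sqrtC (D 0 i)) = sqrtC (D 0 i).
  by apply/CrealP; exact: ger0_real.
by rewrite -expr2 sqrtCK.
Qed.

(* Adding a small multiple of the identity makes rho positive definite without
   destroying strict negativity at Z0; a congruence then normalises it to 1. *)
Lemma monic_pencil_of_form r rho (B : 'I_r -> 'M[C]_N) (Z0 : 'I_r -> H -> H) f u :
  ip u u = 1 -> rho \is hermsymmx -> (forall j, B j \is hermsymmx) ->
  (forall h, 0 <= op_form ip rho id h) ->
  (forall j, linear (Z0 j)) -> tuple_form ip rho B Z0 f < 0 ->
  exists A : 'I_r -> 'M[C]_N, [/\ hermitian_coeffs A,
    forall Z, (forall j, linear (Z j)) ->
      (forall h, 0 <= tuple_form ip rho B Z h) -> psd ip (linear_pencil A Z) &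
    ~ psd ip (linear_pencil A Z0)].
Proof.
move=> u1 hrho hB rho0 lZ0 neg.
set x := tuple_form _ _ _ _ _ in neg.
pose s := \sum_a ip (f a) (f a).
have s0 : 0 <= s by apply: sumr_ge0 => a _; exact: ip_ge0.
have s1 : 0 < s + 1 by rewrite ltr_wpDl.
(* Chosen so that [x + eps * (s + 1) = x / 2]; the perturbed value [x + eps * s] at [f] is then
   still negative. *)
pose eps := - x / 2 / (s + 1).
have eps0 : 0 < eps by rewrite !divr_gt0 // oppr_gt0.
pose rho' := rho + eps%:M.
have formE Z h : tuple_form ip rho' B Z h =
    tuple_form ip rho B Z h + eps * \sum_a ip (h a) (h a).
  by rewrite /tuple_form op_form_add op_form_scalar addrAC.
have [|P i PP|S uS rhoE] := @hermitian_factor rho'.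
- apply/hermsymmxP/matrixP => a b; rewrite !mxE {1}(hermsymmxP _ hrho) !mxE /=.
  rewrite rmorphD rmorphMn /= [b == a]eq_sym; congr (_ + _ *+ _).
  by apply/esym/CrealP; exact: gtr0_real.
- rewrite mulmxDr mulmxDl mxE -(op_form_rank1 _ _ _ u1) ltr_wpDl //.
  by rewrite mul_mx_scalar -scalemxAl PP mxE mxE eqxx mulr1.
pose Q := invmx S.
have SQ : S *m Q = 1%:M by exact: mulmxV.
have QS : Q *m S = 1%:M by exact: mulVmx.
have rho1 : Q ^t* *m rho' *m Q = 1%:M.
  rewrite rhoE !mulmxA -mulmxA SQ mulmx1 -map_mxM -trmx_mul SQ.
  by rewrite trmx1 map_mx1.
exists (fun j => Q ^t* *m B j *m Q).
have AE Z h : (forall j, linear (Z j)) ->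
    tuple_form ip 1%:M (fun j => Q ^t* *m B j *m Q) Z h =
    tuple_form ip rho' B Z (fun a => \sum_i Q a i *: h i).
  move=> lZ; rewrite /tuple_form op_form_congr // rho1; congr (_ + _).
  by apply: eq_bigr => j _; rewrite op_form_congr.
split.
- by move=> j; apply: hermsymmx_congr.
- move=> Z lZ Z_ge0; apply/psd_linear_pencil => h; rewrite AE // formE.
  apply: addr_ge0 => //; apply: mulr_ge0; first exact: ltW.
  by apply: sumr_ge0 => a _; exact: ip_ge0.
(* The congruence by [Q] is undone by testing at the image of [f] under [S]. *)
move=> /psd_linear_pencil/(_ (fun i => \sum_a S i a *: f a)); rewrite AE //.
have -> : (fun a => \sum_i Q a i *: (\sum_a S i a *: f a)) = f.
  apply/funext => a; under eq_bigr do rewrite scaler_sumr.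
  rewrite exchange_big /=.
  transitivity (\sum_b (Q *m S) a b *: f b).
    apply: eq_bigr => b _; rewrite mxE scaler_suml.
    by apply: eq_bigr => i _; rewrite scalerA.
  rewrite QS (bigD1 a) //= big1 ?addr0 => [|b /negbTE ba].
    by rewrite mxE eqxx scale1r.
  by rewrite mxE eq_sym ba scale0r.
rewrite formE -/x -/s => x_ge0.
have : x + eps * (s + 1) = x / 2.
  by rewrite /eps divfK ?gt_eqF // mulNr; field.
have : x / 2 < 0 by rewrite pmulr_llt0.
move=> h1 h2; have : x / 2 < x / 2.
  apply: lt_le_trans h1 _; apply: le_trans x_ge0 _.
  by rewrite -h2 lerD2l ler_pM2l // lerDl.
by rewrite ltxx.
Qed.

End MonicPencil.

(** * Moments and separation *)

Section Moments.
Context {R : realType} {H : completeNormedModType R[i]}.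
Context {ip : {dot H for @Num.conj R[i]}}.
Local Notation C := R[i].
Local Notation Re := (@complex.Re R).
Local Notation Im := (@complex.Im R).
Context {r : nat}.
Implicit Types (Z : 'I_r -> H -> H).

(* The r-tuple Z preceded by the identity, so that Gram matrices and matrices
   of the Z j are handled by the same formulas. *)
Definition unital_tuple Z (o : 'I_r.+1) : H -> H :=
  if unlift ord0 o is Some j then Z j else id.

Definition moment N Z (h : 'I_N -> H) (o : 'I_r.+1) (a b : 'I_N) : C :=
  ip (unital_tuple Z o (h b)) (h a).

(** Real and imaginary parts are separate coordinates, because the cone separation is over the
    reals. *)
Definition moment_vector N Z (h : 'I_N -> H)
    (x : 'I_r.+1 * 'I_N * 'I_N * bool) : R :=
  let z := moment Z h x.1.1.1 x.1.1.2 x.1.2 in if x.2 then Re z else Im z.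

Lemma unital_tuple0 Z : unital_tuple Z ord0 = id.
Proof. by rewrite /unital_tuple unlift_none. Qed.

Lemma unital_tuple_lift Z j : unital_tuple Z (lift ord0 j) = Z j.
Proof. by rewrite /unital_tuple liftK. Qed.

Lemma unital_tuple_sa Z o : sa_tuple ip Z ->
  bounded_op (unital_tuple Z o) /\ selfadjoint ip (unital_tuple Z o).
Proof.
move=> saZ; rewrite /unital_tuple; case: unliftP => [j _|_]; first exact: saZ.
by split; [exact: bounded_op_id|].
Qed.

Lemma ReD (x y : C) : Re (x + y) = Re x + Re y.
Proof. by case: x y => [? ?] [? ?]. Qed.

Lemma ImD (x y : C) : Im (x + y) = Im x + Im y.
Proof. by case: x y => [? ?] [? ?]. Qed.

(** A real functional of the moments is the real part of a complex one with coefficients [c]. Moment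
    matrices of self-adjoint tuples are Hermitian, so averaging [c] with its adjoint yields
    Hermitian coefficients whose form is that real part. *)
Lemma moment_vector_dot N (y : 'I_r.+1 * 'I_N * 'I_N * bool -> R) :
  exists rho (B : 'I_r -> 'M[C]_N), [/\ rho \is hermsymmx,
    forall j, B j \is hermsymmx &
    forall Z h, sa_tuple ip Z ->
      tuple_form ip rho B Z h = (\sum_x y x * moment_vector Z h x)%:C].
Proof.
have [c cdef] : exists c : 'I_r.+1 -> 'I_N -> 'I_N -> C, forall o a b,
    c o a b = (y (o, a, b, true))%:C - 'i%C * (y (o, a, b, false))%:C.
  by exists (fun o a b => (y (o, a, b, true))%:C - 'i%C * (y (o, a, b, false))%:C).
pose B o : 'M[C]_N := \matrix_(a, b) (2^-1 * (c o a b + (c o b a)^*)).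
have hB o : B o \is hermsymmx.
  apply/hermsymmxP/matrixP => a b; rewrite !mxE /= rmorphM /= rmorphD /= conjCK.
  by rewrite addrC fmorphV /= conjC_nat.
have cE o a b z : Re (c o a b * z) =
    \sum_t y (o, a, b, t) * (if t then Re z else Im z).
  rewrite big_bool cdef; case: z => z1 z2; simpc => /=; ring.
have BE o T h : selfadjoint ip T -> op_form ip (B o) T h =
    (\sum_a \sum_b \sum_t y (o, a, b, t) *
      (if t then Re (ip (T (h b)) (h a)) else Im (ip (T (h b)) (h a))))%:C.
  move=> sT; pose z := \sum_a \sum_b c o a b * ip (T (h b)) (h a).
  have zE : z = \sum_a \sum_b c o b a * ip (T (h a)) (h b) by exact: exchange_big.
  have -> : op_form ip (B o) T h = 2^-1 * (z + z^*).
    rewrite {2}zE rmorph_sum /z /op_form -big_split mulr_sumr.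
    apply: eq_bigr => a _ /=; rewrite rmorph_sum -big_split mulr_sumr.
    apply: eq_bigr => b _ /=; rewrite mxE rmorphM /= -ipC -sT; ring.
  have -> : 2^-1 * (z + z^*) = (Re z)%:C by rewrite ReJ_add mulrC.
  congr (_%:C); rewrite /z.
  rewrite (big_morph Re ReD (erefl _)); apply: eq_bigr => a _.
  rewrite (big_morph Re ReD (erefl _)); apply: eq_bigr => b _.
  by rewrite cE.
exists (B ord0), (fun j => B (lift ord0 j)); split=> // Z h saZ.
have -> : tuple_form ip (B ord0) (fun j => B (lift ord0 j)) Z h =
    \sum_o op_form ip (B o) (unital_tuple Z o) h.
  rewrite big_ord_recl unital_tuple0; congr (_ + _); apply: eq_bigr => j _.
  by rewrite unital_tuple_lift.
under eq_bigr => o _ do rewrite (BE o _ h (unital_tuple_sa o saZ).2).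
rewrite -rmorph_sum; congr (_%:C).
have sum_pair (I I' : finType) (F : I * I' -> R) :
    \sum_p F p = \sum_i \sum_i' F (i, i').
  by rewrite pair_bigA; apply: eq_bigr => -[].
by rewrite !sum_pair.
Qed.

End Moments.
Arguments moment {R H} ip {r N} Z h o a b.
Arguments moment_vector {R H} ip {r N} Z h x.

Section Separation.
Context {R : realType} {H : completeNormedModType R[i]}.
Context {ip : {dot H for @Num.conj R[i]}}.
Context (ip_norm : forall v : H, ip v v = `|v| ^+ 2).
Context {e : nat -> H} (be : orthonormal_basis ip e).
Local Notation C := R[i].
Context (g r : nat) (Gam : 'I_r -> free_poly C g).
Context (Gam_sym : forall j, fsymmetric (Gam j)).
Context (K : set ('I_g -> H -> H)).
Context (K_free : free_set ip K) (K_nonempty : K !=set0).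

(** Sums of data come from a direct sum of two tuples and of their vectors; a factor [t] comes from
    scaling the vectors by its square root, moments being quadratic in [h]. *)
Lemma moment_cone N : 
  let Q := [set q | exists X (h : 'I_N -> H),
              K X /\ q = moment_vector ip (tuple_eval Gam X) h] in
  [/\ Q !=set0,
    forall p q, Q p -> Q q -> Q (fun i => p i + q i) &
    forall t p, 0 <= t -> Q p -> Q (fun i => t * p i)].
Proof.
have [K_sa _ K_sum] := K_free.
split.
- have [X KX] := K_nonempty.
  by exists (moment_vector ip (tuple_eval Gam X) (fun _ : 'I_N => 0)), X, (fun=> 0).
- move=> _ _ [X1 [h1 [KX1 ->]]] [X2 [h2 [KX2 ->]]].
  have [W [W' sumW]] := exists_sum_unitary2 ip_norm be.
  pose X (i : 'I_2) := if i == ord0 then X1 else X2.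
  pose h a := W (fun i : 'I_2 => if i == ord0 then h1 a else h2 a).
  exists (direct_sum W W' X), h; split.
    by apply: K_sum => // i; rewrite /X; case: eqP.
  apply/funext => x; rewrite /moment_vector.
  suff -> : moment ip (tuple_eval Gam (direct_sum W W' X)) h x.1.1.1 x.1.1.2 x.1.2 =
      moment ip (tuple_eval Gam X1) h1 x.1.1.1 x.1.1.2 x.1.2 +
      moment ip (tuple_eval Gam X2) h2 x.1.1.1 x.1.1.2 x.1.2.
    by case: x.2; rewrite (ReD, ImD).
  have [_ _ KW _] := sumW.
  rewrite /moment (sum_unitary_ip sumW) !big_ord_recl big_ord0 addr0.
  rewrite /unital_tuple; case: unliftP => [j _|_]; last by rewrite /h !KW.
  by rewrite !(poly_eval_direct_sum sumW) /h !KW /X.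
move=> t _ t0 [X [h [KX ->]]]; exists X, (fun a => (Num.sqrt t)%:C *: h a).
split=> //; apply/funext => x; rewrite /moment_vector.
suff -> : moment ip (tuple_eval Gam X) (fun a => (Num.sqrt t)%:C *: h a)
      x.1.1.1 x.1.1.2 x.1.2 =
    t%:C * moment ip (tuple_eval Gam X) h x.1.1.1 x.1.1.2 x.1.2.
  by case: x.2; case: (moment _ _ _ _ _ _) => ? ?; rewrite /= mul0r ?subr0 ?addr0.
have [[lT _] _] := unital_tuple_sa x.1.1.1 (tuple_eval_sa Gam_sym (K_sa _ KX)).
rewrite /moment (linear_opZ _ _ lT) ipZl ipZr mulrA; congr (_ * _).
have -> : ((Num.sqrt t)%:C)^* = (Num.sqrt t)%:C :> C by exact: conjc_real.
by rewrite -rmorphM /= -expr2 sqr_sqrtr.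
Qed.

Lemma form_separation N Y (f : 'I_N -> H) : sa_tuple ip Y ->
  (forall eps : R, 0 < eps -> exists X h, K X /\
     \sum_x (moment_vector ip (tuple_eval Gam X) h x -
             moment_vector ip (tuple_eval Gam Y) f x) ^+ 2 < eps) \/
  exists rho (B : 'I_r -> 'M[C]_N), [/\ rho \is hermsymmx,
    forall j, B j \is hermsymmx,
    forall X h, K X -> 0 <= tuple_form ip rho B (tuple_eval Gam X) h &
    tuple_form ip rho B (tuple_eval Gam Y) f < 0].
Proof.
move=> saY.
set approx := (X in X \/ _); have [|napprox] := pselect approx; first by left.
right; have [eps [eps0 far]] : exists eps : R, 0 < eps /\ forall X h, K X ->
    eps <= \sum_x (moment_vector ip (tuple_eval Gam X) h x -
             moment_vector ip (tuple_eval Gam Y) f x) ^+ 2.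
  apply: contrapT => nfar; apply: napprox => eps eps0; apply: contrapT => nX.
  apply: nfar; exists eps; split=> // X h KX; rewrite leNgt; apply/negP => lt_eps.
  by apply: nX; exists X, h.
have [Q0 QD QZ] := moment_cone N.
have [|y [yQ yY]] := cone_separation (q0 := moment_vector ip (tuple_eval Gam Y) f)
    eps0 Q0 QD QZ; first by move=> _ [X [h [KX ->]]]; exact: far.
have [rho [B [hrho hB formE]]] := moment_vector_dot (ip := ip) y.
have [K_sa _ _] := K_free.
exists rho, B; split=> // [X h KX|].
  rewrite formE ?ler0c; last exact: tuple_eval_sa (K_sa _ KX).
  by apply: yQ; exists X, h.
by rewrite formE ?ltcR; last exact: tuple_eval_sa.
Qed.

End Separation.

(** * From approximable moments to membership in the Gamma-convex set *)

Section GammaSeparation.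
Context {R : realType} {H : completeNormedModType R[i]}.
Context {ip : {dot H for @Num.conj R[i]}}.
Context (ip_norm : forall v : H, ip v v = `|v| ^+ 2).
Context (H_infinite : infinite_dimensional H).
Context {e : nat -> H} (be : orthonormal_basis ip e).
Local Notation C := R[i].
Local Notation Co := (R[i]^o).
Context (g r : nat) (le_gr : (g <= r)%N) (Gam : 'I_r -> free_poly C g).
Context (Gam_sym : forall j, fsymmetric (Gam j)).
Context (Gam_var : forall j : 'I_g, Gam (widen_ord le_gr j) = fvar j).
Context (K : set ('I_g -> H -> H)).
Context (K_sa : K `<=` sa_tuple ip (g := g)).
Context (K_closed : sot_closed ip K).
Context (K_convex : gamma_convex ip Gam K).
Context (K_bounded : norm_bounded K).
Context (K_zero : opco ip (tuple_eval Gam @` K) (zero_tuple H r)).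
Context (Y : 'I_g -> H -> H) (saY : sa_tuple ip Y).

(** Since the first [g] entries of [Gam] are the variables, matching the compression of Gamma(X)
    with Gamma(Y) already forces the compression of [X] to be [Y], and [V] then forms a Gamma-pair
    with [X]. *)
Lemma gamma_mem X V : K X -> isometry_op ip V ->
  (forall j u v, ip (tuple_eval Gam X j (V u)) (V v) = ip (tuple_eval Gam Y j u) v) ->
  K Y.
Proof.
move=> KX iV XY; have saX := K_sa KX; have bV := isometry_bounded ip_norm iV.
have GX : compress ip V (tuple_eval Gam X) = tuple_eval Gam Y.
  apply/funext => j; apply/funext => v; apply: (@ip_extr _ _ ip) => u.
  rewrite /compress -(adjointP ip_norm be) //.
  by rewrite -(tuple_eval_sa Gam_sym saX j).2 XY (tuple_eval_sa Gam_sym saY j).2.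
have var Z j : tuple_eval Gam Z (widen_ord le_gr j) = Z j.
  by rewrite /tuple_eval Gam_var poly_eval_fvar.
have VX : compress ip V X = Y.
  apply/funext => j; rewrite -[RHS]var -GX.
  by apply/funext => v; rewrite /compress var.
by rewrite -VX; apply: (K_convex.2 _ _ KX); split=> //; rewrite VX.
Qed.

(** Approximants for ever smaller errors have an ultralimit with the exact moments. A growing [N]
    treats a whole basis; a constant [N] treats a family that vanishes from [N] on. *)
Lemma moments_attained (f : nat -> H) (N : nat -> nat) :
  (forall a, \forall n \near \oo, (a < N n)%N \/ f a = 0) ->
  (forall n (eps : R), 0 < eps -> exists X (h : 'I_(N n) -> H), K X /\
     \sum_x (moment_vector ip (tuple_eval Gam X) h x -
       moment_vector ip (tuple_eval Gam Y) (fun i : 'I_(N n) => f i) x) ^+ 2 < eps) ->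
  exists X kap, K X /\ forall o a b,
    ip (unital_tuple (tuple_eval Gam X) o (kap b)) (kap a) =
    ip (unital_tuple (tuple_eval Gam Y) o (f b)) (f a).
Proof.
move=> fN approx.
(* One summand for the real part and one for the imaginary part of a moment. *)
pose err n : R := n.+1%:R^-1 + n.+1%:R^-1.
have /choice[X Xk] n : exists X k, [/\ K X, forall a, (N n <= a)%N -> k a = 0 &
    forall o a b, (a < N n)%N -> (b < N n)%N ->
      `|ip (unital_tuple (tuple_eval Gam X) o (k b)) (k a) -
        ip (unital_tuple (tuple_eval Gam Y) o (f b)) (f a)| <= (err n)%:C].
  have d0 : 0 < n.+1%:R^-1 :> R by [].
  have [X [h [KX hX]]] := approx n _ (exprn_gt0 2 d0).
  (* The finite family is padded with zeros to a sequence. *)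
  exists X, (fun a => if insub a is Some i then h i else 0); split=> //.
    by move=> a Na; rewrite insubN // -leqNgt.
  move=> o a b aN bN; rewrite !insubT.
  set i := Sub a aN; set j := Sub b bN.
  pose z := moment ip (tuple_eval Gam X) h o i j -
    moment ip (tuple_eval Gam Y) (fun i : 'I_(N n) => f i) o i j.
  have small t : `|if t then complex.Re z else complex.Im z| <= n.+1%:R^-1.
    have : (if t then complex.Re z else complex.Im z) ^+ 2 <= n.+1%:R^-1 ^+ 2.
      apply: le_trans (ltW hX); rewrite (bigD1 (o, i, j, t)) //=.
      rewrite [X in _ <= X + _](_ : _ =
          (if t then complex.Re z else complex.Im z) ^+ 2).
        by rewrite lerDl sumr_ge0 // => x _; exact: sqr_ge0.
      rewrite /moment_vector /= /z; case: t; congr (_ ^+ 2);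
        by case: (moment _ _ _ _ _ _) (moment _ _ _ _ _ _) => [? ?] [? ?].
    by rewrite -[X in X <= _ -> _]real_normK ?num_real // ler_sqr ?nnegrE ?(ltW d0).
  rewrite -[X in `|X|]/z [z]complexE; apply: le_trans (ler_normD _ _) _.
  rewrite normrM complexiE normCi mul1r /err rmorphD.
  have nC (x : R) : `|x%:C| = `|x|%:C.
    by rewrite normc_def /= expr0n addr0 sqrtr_sqr.
  by apply: lerD; rewrite nC lecR; [exact: (small true)|exact: (small false)].
have /choice[k kP] := Xk.
have [U [UU sU]] := exists_ultrafilter_nat.
have errU : (fun n => (err n)%:C : Co) @ U --> (0 : Co).
  apply: (@cvg_real_complex _ _ U _ _ 0); rewrite -[0](addr0 (0 : R)).
  have invU : (fun n => n.+1%:R^-1 : R) @ U --> (0 : R).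
    by apply: cvg_trans (@cvg_harmonic R) => A /sU.
  exact: (cvgD invU invU).
have lim_k o a b :
    (fun n => ip (unital_tuple (tuple_eval Gam (X n)) o (k n b)) (k n a) : Co) @ U -->
    (ip (unital_tuple (tuple_eval Gam Y) o (f b)) (f a) : Co).
  apply: cvg_dominated errU; apply: sU.
  near=> n; have [KX k0 kE] := kP n.
  have fa : (a < N n)%N \/ f a = 0 by near: n; exact: fN.
  have fb : (b < N n)%N \/ f b = 0 by near: n; exact: fN.
  have lin Z : sa_tuple ip Z -> linear (unital_tuple (tuple_eval Gam Z) o).
    move=> saZ.
    by have [[]] := unital_tuple_sa o (tuple_eval_sa Gam_sym saZ).
  have err0 : 0 <= (err n)%:C by rewrite ler0c addr_ge0.
  have [aN|Na] := ltnP a (N n); last first.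
    have -> : f a = 0 by case: fa => //; rewrite ltnNge Na.
    by rewrite (k0 a) // !ip0r subrr normr0.
  have [bN|Nb] := ltnP b (N n); last first.
    have -> : f b = 0 by case: fb => //; rewrite ltnNge Nb.
    rewrite (k0 b) // (linear_op0 (lin _ saY)) (linear_op0 (lin _ (K_sa KX))).
    by rewrite !ip0l subrr normr0.
  exact: kE.
have KXn n : K (X n) by case: (kP n).
(* The moment of the identity converges, so squared norms are eventually bounded; a bound on a
   square is turned into a bound on the norm by adding 1. *)
have kM a : exists M : C, \forall n \near U, `|k n a| <= M.
  exists (`|ip (f a) (f a)| + 1 + 1).
  have lt1 : `|ip (f a) (f a)| < `|ip (f a) (f a)| + 1 by rewrite ltrDl.
  have lk : (fun n => ip (k n a) (k n a) : Co) @ U --> (ip (f a) (f a) : Co).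
    have := lim_k ord0 a a; rewrite unital_tuple0.
    have -> // : (fun n => ip (unital_tuple (tuple_eval Gam (X n)) ord0 (k n a))
      (k n a) : Co) = fun n => ip (k n a) (k n a).
    by apply/funext => n; rewrite unital_tuple0.
  pose proof (cvgr_norm_le _ lk _ lt1) as near_k.
  apply: filterS near_k => n; rewrite ip_norm normrX normr_id => kn.
  have [k1|k1] := real_leP (normr_real (k n a)) (real1 C).
    by apply: le_trans k1 _; rewrite lerDr addr_ge0.
  apply: le_trans (le_trans _ kn) _; last by rewrite lerDl.
  by rewrite expr2 ler_peMl // ltW.
have [Xt [kap [KXt cvgX]]] := gamma_convex_ultralimit ip_norm H_infinite be
  K_sa K_closed K_convex K_bounded KXn kM.
exists Xt, kap; split=> // o a b.
(* The identity is the value of the empty word, so Gram entries are polynomial moments too. *)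
pose p : free_poly C g := if unlift ord0 o is Some j then Gam j else << FMonom [::] >>.
have pE Z : poly_eval p Z = unital_tuple (tuple_eval Gam Z) o.
  rewrite /p /unital_tuple; case: unliftP => // _.
  by apply/funext => v; rewrite poly_evalU scale1r.
pose proof (cvgX p b a) as Xlim; rewrite pE in Xlim; apply: (cvg_uniq Xlim).
rewrite (_ : (fun n => ip (poly_eval p (X n) (k n b)) (k n a) : Co) = fun n =>
    ip (unital_tuple (tuple_eval Gam (X n)) o (k n b)) (k n a)); first exact: lim_k.
by apply/funext => n; rewrite pE.
Unshelve. all: by end_near. Qed.

(** The empty set is operator convex, direct sums having at least one summand, so the hull of an
    empty set would be empty and could not contain 0. *)
Lemma opco_zero_nonempty : K !=set0.
Proof.
apply: contrapT => nK; have K0 : tuple_eval Gam @` K = set0.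
  by apply/seteqP; split=> // Z [X KX _]; case: nK; exists X.
have oc0 : operator_convex ip (set0 : set ('I_r -> H -> H)).
  split; last by []; split=> // n W W' X n0 _ /(_ (Ordinal n0)).
  by [].
by have := K_zero (conj oc0 (fun Z (SZ : (tuple_eval Gam @` K) Z) =>
  eq_ind _ (fun S => S Z) SZ _ K0)).
Qed.

Lemma pencil_separation N (f : 'I_N -> H) :
  (forall eps : R, 0 < eps -> exists X h, K X /\
     \sum_x (moment_vector ip (tuple_eval Gam X) h x -
             moment_vector ip (tuple_eval Gam Y) f x) ^+ 2 < eps) \/
  exists A : 'I_r -> 'M[C]_N, hermitian_coeffs A /\ separates ip A Gam K Y.
Proof.
have [|[rho [B [hrho hB formK formY]]]] :=
  form_separation ip_norm be Gam_sym K_convex.1 opco_zero_nonempty f saY.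
  by left.
right.
have opco_form Z : opco ip (tuple_eval Gam @` K) Z ->
    forall h, 0 <= tuple_form ip rho B Z h.
  apply: (opco_tuple_form ip_norm be) => _ [X KX <-]; split.
    by apply: tuple_eval_sa Gam_sym _; exact: K_sa.
  by move=> h; exact: formK.
have opco_sa Z : opco ip (tuple_eval Gam @` K) Z -> sa_tuple ip Z.
  (* A form of size 0 is nonnegative everywhere, so its operator convex set consists of all
     self-adjoint tuples. *)
  move=> SZ; pose B0 (j : 'I_r) : 'M[C]_0 := 0.
  have := SZ _ (conj (tuple_form_operator_convex ip_norm be (0 : 'M[C]_0) B0) _).
  case=> // _ [X KX <-]; split; first by apply: tuple_eval_sa Gam_sym _; exact: K_sa.
  move=> h; rewrite /tuple_form /op_form big_ord0 add0r sumr_ge0 // => j _.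
  by rewrite big_ord0.
have sa_lin (Z : 'I_r -> H -> H) : sa_tuple ip Z -> forall j, linear (Z j).
  by move=> saZ j; have [[]] := saZ j.
(* At the zero tuple only the constant coefficient survives; this is where 0 in the hull enters. *)
have rho_ge0 h : 0 <= op_form ip rho id h.
  have := opco_form _ K_zero h; rewrite /tuple_form [X in _ + X]big1 ?addr0 // => j _.
  by rewrite /op_form big1 // => a _; rewrite big1 // => b _; rewrite ip0l mulr0.
have u1 : ip (e 0%N) (e 0%N) = 1 by rewrite be.1 eqxx.
have [A [hA A_psd A_Y]] := monic_pencil_of_form u1 hrho hB rho_ge0
  (sa_lin _ (tuple_eval_sa Gam_sym saY)) formY.
exists A; split=> //; split=> //.
  by move=> Z oZ; apply: A_psd; [exact/sa_lin/opco_sa|exact: opco_form].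
move=> X KX; apply: A_psd; last by move=> h; exact: formK.
by apply/sa_lin/tuple_eval_sa => //; exact: K_sa.
Qed.

(** Without a separating pencil, the moments of every initial segment of the basis can be
    approximated from [K]; attaining them all exhibits [Y] as a compression of an element of [K]. *)
Lemma exists_separating_pencil : ~ K Y -> exists N (A : 'I_r -> 'M[C]_N),
  [/\ (0 < N)%N, hermitian_coeffs A & separates ip A Gam K Y].
Proof.
move=> nKY; apply: contrapT => nA.
have [|n eps eps0|X [kap [KX XY]]] := @moments_attained e S.
- by move=> a; exists a => // n /= an; left.
- have [approx|[A [hA sA]]] := pencil_separation (fun i : 'I_n.+1 => e i).
    exact: approx.
  by case: nA; exists n.+1, A.
have okap : orthonormal_family ip kap.
  by move=> a b; have := XY ord0 b a; rewrite !unital_tuple0 /= be.1.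
have [V iV Ve] := isometry_of_families ip_norm be okap.
have bV := isometry_bounded ip_norm iV.
have saG Z j : sa_tuple ip Z -> bounded_op (tuple_eval Gam Z j).
  by move=> saZ; have [] := tuple_eval_sa Gam_sym saZ j.
apply/nKY/(gamma_mem KX iV) => j u v.
(* Equal matrix entries in the basis give equality of the bounded operators, hence of the forms at
   all [u] and [v]. *)
have E : (fun u => adjoint ip V (tuple_eval Gam X j (V u))) = tuple_eval Gam Y j.
  apply: (basis_eq_op be) => [||b].
  - apply: bounded_op_comp (adjoint_bounded ip_norm be bV) _.
    exact: bounded_op_comp (saG _ _ (K_sa KX)) bV.
  - exact: saG.
  apply: (basis_extl be) => a.
  rewrite ipC -(adjointP ip_norm be) // -ipC !Ve.
  by have := XY (lift ord0 j) a b; rewrite !unital_tuple_lift.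
by rewrite -E ipC (adjointP ip_norm be) // -ipC.
Qed.

(** * Pencils whose size is the dimension of the support *)

Section FiniteSupport.
Context {l : nat} {F : set H} (dimF : subspace_of_dim l F).
Context (Y_supp : supported_on ip F Y).
Context (K0 : K (zero_tuple H g)).
Context (Gam0 : tuple_eval Gam (zero_tuple H g) = zero_tuple H r).

(** The first [l] vectors of [c] span a space containing [F], so a vector orthogonal to them is
    killed by [Y]; there Gamma(Y) agrees with Gamma(0), which is 0. *)
Lemma exists_orthonormal_cover : exists2 c : nat -> H,
  orthonormal_family ip c &
  forall v, (forall a, (a < l)%N -> ip v (c a) = 0) ->
    forall j, tuple_eval Gam Y j v = 0.
Proof.
have [b _ FE] := dimF.
have [c oc cE] := adaptive_gram_schmidt ip_norm H_infinite
  (fun s => if insub (size s) is Some i then b i else 0).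
exists c => // v vc j.
have vb i : ip (b i) v = 0.
  have := cE i; rewrite size_mkseq valK => ->.
  rewrite ip_suml big1 // => a _; rewrite ipZl (ipC (c a)) vc ?rmorph0 ?mulr0 //.
  by apply: leq_ltn_trans (ltn_ord i); rewrite -ltnS.
have Yv i : Y i v = 0.
  have [_] := Y_supp i; apply=> u; rewrite FE => -[d ->].
  by rewrite ip_suml big1 // => a _; rewrite ipZl vb mulr0.
have Y0 i : Y i 0 = 0 by apply: linear_op0; case: (saY i) => -[].
have wE (w : seq 'I_g) : word_eval Y w v = word_eval (zero_tuple H g) w v.
  elim: w => // i w IH; rewrite [LHS]/= IH.
  by case: w {IH} => [|i' w]; [exact: Yv|exact: Y0].
transitivity (tuple_eval Gam (zero_tuple H g) j v); last by rewrite Gam0.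
by apply: eq_bigr => w _; rewrite wE.
Qed.

(** Matching moments on [l] vectors controls Gamma(Y) only on their span; on its complement, where
    Gamma(Y) vanishes, a zero summand is added to [X]. *)
Lemma exists_separating_pencil_size : ~ K Y ->
  exists A : 'I_r -> 'M[C]_l, hermitian_coeffs A /\ separates ip A Gam K Y.
Proof.
move=> nKY; have [c oc cY] := exists_orthonormal_cover.
pose f a := if (a < l)%N then c a else 0.
have [approx|//] := pencil_separation (fun i : 'I_l => f i).
have [|//|X [kap [KX XY]]] := @moments_attained f (fun=> l).
  by move=> a; exists 0%N => // n _; rewrite /f; case: ltnP; [left|right].
case: nKY.
have ol : orthonormal_family ip (fun i : 'I_l => c i) := orthonormal_ord oc.
have okap : orthonormal_family ip (fun i : 'I_l => kap i).
  move=> a b; have := XY ord0 b a.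
  by rewrite !unital_tuple0 /= /f !ltn_ord => ->; exact: ol.
have XYl j (a b : 'I_l) : ip (tuple_eval Gam X j (kap b)) (kap a) =
    ip (tuple_eval Gam Y j (c b)) (c a).
  by have := XY (lift ord0 j) a b; rewrite !unital_tuple_lift /f !ltn_ord.
have [W [W' sumW]] := exists_sum_unitary2 ip_norm be.
have [lW ipW KW _] := sumW.
pose P := oproj ip (fun i : 'I_l => c i).
have lP : linear P := oproj_linear _.
pose V0 v := \sum_(i < l) ip v (c i) *: kap i.
have lV0 : linear V0.
  move=> a u v; rewrite /V0 scaler_sumr -big_split; apply: eq_bigr => i _ /=.
  by rewrite ipDl ipZl scalerDl scalerA.
(* The projected part of [v] is carried to the [kap] and the rest is kept in the second summand; the
   two squared norms add up to that of [v]. *)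
pose V v := W (fun i : 'I_2 => if i == ord0 then V0 v else v - P v).
have iV : isometry_op ip V.
  split.
    move=> a u v; rewrite /V -lW; congr W; apply/funext => i.
    rewrite -[RHS]/(a *: (if i == ord0 then V0 u else u - P u) +
      (if i == ord0 then V0 v else v - P v)).
    case: eqP => _; first exact: lV0.
    by rewrite lP scalerBr opprD addrACA.
  move=> u v; rewrite ipW !big_ord_recl big_ord0 addr0 /=.
  rewrite (ip_lincomb _ _ okap) -(ip_lincomb _ _ ol) -/(P u) -/(P v).
  have oPP x y : ip (x - P x) (P y) = 0 by exact: oproj_orth_lincomb.
  have PuvP : ip (P u) (v - P v) = 0 by rewrite ipC oPP rmorph0.
  rewrite -[in RHS](subrK (P u) u) -[in RHS](subrK (P v) v).
  rewrite (ipDl (u - P u) (P u)) !(ipDr _ (v - P v) (P v)) oPP PuvP.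
  by rewrite addr0 add0r addrC.
have KX' : K (direct_sum W W' (fun i : 'I_2 => if i == ord0 then X else zero_tuple H g)).
  have [_ _ K_sum] := K_convex.1.
  by apply: K_sum => // i; case: eqP.
apply: (gamma_mem KX' iV) => j u v.
have saGX := tuple_eval_sa Gam_sym (K_sa KX) j.
have saGY := tuple_eval_sa Gam_sym saY j.
(* Together with self-adjointness this replaces both arguments of the form of Gamma(Y) by their
   projections. *)
have GYP w : tuple_eval Gam Y j w = tuple_eval Gam Y j (P w).
  apply/eqP; rewrite -subr_eq0 -(linear_opB _ _ saGY.1.1); apply/eqP/cY => a al.
  exact: (oproj_orth ol w (Ordinal al)).
rewrite (sum_unitary_ip sumW) !big_ord_recl big_ord0 addr0.
rewrite !(poly_eval_direct_sum sumW) /V !KW /=.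
have -> : poly_eval (Gam j) (zero_tuple H g) (u - P u) = 0.
  by rewrite -[LHS]/(tuple_eval Gam (zero_tuple H g) j (u - P u)) Gam0.
rewrite ip0l addr0 GYP saGY.2 GYP -saGY.2 -/(tuple_eval Gam X j).
rewrite /V0 /P /oproj !(linear_op_sum _ _ _ saGX.1.1) !(linear_op_sum _ _ _ saGY.1.1).
rewrite !ip_suml; apply: eq_bigr => b _; rewrite !ip_sumr; apply: eq_bigr => a _.
rewrite (linear_opZ _ _ saGX.1.1) (linear_opZ _ _ saGY.1.1) !ipZl !ipZr.
by rewrite XYl.
Qed.

End FiniteSupport.

End GammaSeparation.

Theorem theorem3p8
  (R : realType) (H : completeNormedModType R[i])
  (ip : {dot H for @Num.conj R[i]})
  (ip_norm : forall v : H, ip v v = `|v| ^+ 2)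
  (H_separable : separable_space H)
  (H_infinite : infinite_dimensional H)
  (g r : nat) (le_gr : (g <= r)%N)
  (Gam : 'I_r -> free_poly R[i] g)
  (Gam_sym : forall j, fsymmetric (Gam j))
  (Gam_var : forall j : 'I_g, Gam (widen_ord le_gr j) = fvar j)
  (K : set ('I_g -> H -> H))
  (K_sa : K `<=` sa_tuple ip (g := g))
  (K_closed : sot_closed ip K)
  (K_convex : gamma_convex ip Gam K)
  (K_bounded : norm_bounded K)
  (K_zero : opco ip (tuple_eval Gam @` K) (zero_tuple H r)) :
  [/\ (forall Y, sa_tuple ip Y -> ~ K Y ->
         exists N (A : 'I_r -> 'M[R[i]]_N),
           [/\ (0 < N)%N, hermitian_coeffs A & separates ip A Gam K Y]),
      K = [set X | sa_tuple ip X /\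
             forall N (A : 'I_r -> 'M[R[i]]_N),
               (0 < N)%N -> hermitian_coeffs A ->
               K `<=` pencil_domain ip A Gam -> pencil_domain ip A Gam X] &
      (K (zero_tuple H g) ->
       tuple_eval Gam (zero_tuple H g) = zero_tuple H r ->
       forall (l : nat) (F : set H) (Y : 'I_g -> H -> H),
         (0 < l)%N -> subspace_of_dim l F ->
         sa_tuple ip Y -> supported_on ip F Y -> ~ K Y ->
         exists A : 'I_r -> 'M[R[i]]_l,
           hermitian_coeffs A /\ separates ip A Gam K Y)].

Proof.
have [e be] := exists_orthonormal_basis ip_norm H_separable H_infinite.
have sep Y : sa_tuple ip Y -> ~ K Y -> exists N (A : 'I_r -> 'M[R[i]]_N),
    [/\ (0 < N)%N, hermitian_coeffs A & separates ip A Gam K Y].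
  exact: (exists_separating_pencil ip_norm H_infinite be Gam_sym Gam_var).
split=> //.
- apply/seteqP; split=> [X KX|X [saX XL]].
    by split=> [|N A _ _ KA]; [exact: K_sa|exact: KA].
  apply: contrapT => nKX; have [N [A [N0 hA [_ _ KA XA]]]] := sep X saX nKX.
  have [|_ //] := XL N A N0 hA.
  by move=> Z KZ; split; [exact: K_sa|exact: KA].
move=> K0 Gam0 l F Y _ dimF saY suppY nKY.
exact: (exists_separating_pencil_size ip_norm H_infinite be Gam_sym Gam_var
  K_sa K_closed K_convex K_bounded K_zero saY dimF suppY K0 Gam0 nKY).
Qed.
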